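(* Suppose that $H$ is a $\mathbb Z_{\ge0}$-graded cocommutative bialgebra over $\mathbb Z$ whose homogeneous pieces are finitely generated free abelian groups and such that the degree $0$ piece is spanned by $1$. Suppose that the shifts $V_p:H/pH\to H/pH$ are onto for all primes $p$. Then every primitive element of $H$ is liftable.
   Context: For a cocommutative coalgebra $C$ over the field $\mathbb F_p$, the shift (Verschiebung) $V_p:C\to C$ is the homomorphism dual to the Frobenius map $f\mapsto f^p$ of the dual algebra $C^*$: it is the unique linear map with $f(V_p(c))=(f^p)(c)$ for all $f\in C^*$, $c\in C$. For $H$ over $\mathbb Z$, $V_p$ denotes the shift of the $\mathbb F_p$-coalgebra $H/pH$. An element $a\in H$ is primitive if $\Delta(a)=a\otimes1+1\otimes a$. An element $a_1\in H$ is liftable if there are $a_n\in H$ ($n\ge0$), with $a_0=1$ and the given $a_1$, such that $\Delta(a_n)=\sum_{0\le m\le n}a_m\otimes a_{n-m}$ for all $n\ge0$. *)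

(* Defs.v *)
From HB Require Import structures.
From mathcomp Require Import all_boot all_order all_algebra.
From mathcomp Require Import boolp classical_sets.

Set Implicit Arguments.
Unset Strict Implicit.
Unset Printing Implicit Defensive.

Import GRing.Theory.
Local Open Scope ring_scope.
Local Open Scope quotient_scope.

Section TensorProduct.
Variables (R : comNzRingType) (M N : lmodType R).

(* A list of pairs stands for the formal sum of the corresponding pure tensors;
   [tensor_cong] is the congruence on formal sums generated by commutativity
   and R-bilinearity. *)
Inductive tensor_cong : seq (M * N) -> seq (M * N) -> Prop :=
| tc_refl s : tensor_cong s s
| tc_sym s t : tensor_cong s t -> tensor_cong t s
| tc_trans s t u : tensor_cong s t -> tensor_cong t u -> tensor_cong s u
| tc_cat s s' t t' :
    tensor_cong s s' -> tensor_cong t t' -> tensor_cong (s ++ t) (s' ++ t')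
| tc_catC s t : tensor_cong (s ++ t) (t ++ s)
| tc_addl x x' y : tensor_cong [:: (x + x', y)] [:: (x, y); (x', y)]
| tc_addr x y y' : tensor_cong [:: (x, y + y')] [:: (x, y); (x, y')]
| tc_scale a x y : tensor_cong [:: (a *: x, y)] [:: (x, a *: y)]
| tc_zero y : tensor_cong [:: (0, y)] [::].

Definition tensor_eq (s t : seq (M * N)) : bool := `[< tensor_cong s t >].

Lemma tensor_eq_equiv : equiv_class_of tensor_eq.
Proof.
split=> [s|s t|t s u].
- by apply/asboolP; exact: tc_refl.
- by apply/asboolP/asboolP; exact: tc_sym.
- by move=> /asboolP st /asboolP tu; apply/asboolP; exact: tc_trans st tu.
Qed.

Canonical tensor_equiv := EquivRelPack tensor_eq_equiv.

Definition tensor := {eq_quot tensor_eq}.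
HB.instance Definition _ : EqQuotient (seq (M * N)) tensor_eq tensor :=
  EqQuotient.on tensor.
HB.instance Definition _ := Choice.on tensor.

Implicit Types (s t : seq (M * N)) (x : M) (y : N).

Lemma tensor_piP s t : tensor_cong s t <-> \pi_tensor s = \pi_tensor t.
Proof.
split=> [st|/eqmodP/asboolP //].
by apply/eqmodP/asboolP.
Qed.

Lemma tensor_reprP s : tensor_cong (repr (\pi_tensor s)) s.
Proof. by apply/tensor_piP; rewrite reprK. Qed.

Definition tzero : tensor := \pi_tensor [::].
Definition tadd (u v : tensor) : tensor := \pi_tensor (repr u ++ repr v).
Definition tscale (a : R) (u : tensor) : tensor :=
  \pi_tensor [seq (a *: z.1, z.2) | z <- repr u].
Definition topp (u : tensor) : tensor := tscale (-1) u.
Definition pure x y : tensor := \pi_tensor [:: (x, y)].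

Lemma tadd_pi s t : tadd (\pi_tensor s) (\pi_tensor t) = \pi_tensor (s ++ t).
Proof. by apply/tensor_piP; apply: tc_cat; exact: tensor_reprP. Qed.

Lemma tscale_pi a s : tscale a (\pi_tensor s) = \pi_tensor [seq (a *: z.1, z.2) | z <- s].
Proof.
apply/tensor_piP; move: (tensor_reprP s); move: (repr _) => s'.
elim=> {s s'} /=.
- by move=> s; exact: tc_refl.
- by move=> s t _; exact: tc_sym.
- by move=> s t u _ + _; exact: tc_trans.
- by move=> s s' t t' _ ss' _ tt'; rewrite !map_cat; exact: tc_cat.
- by move=> s t; rewrite !map_cat; exact: tc_catC.
- by move=> x x' y; rewrite scalerDr; exact: tc_addl.
- by move=> x y y'; exact: tc_addr.
- by move=> b x y; rewrite scalerA mulrC -scalerA; exact: tc_scale.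
- by move=> y; rewrite scaler0; exact: tc_zero.
Qed.

Lemma tensor_pi_ind (P : tensor -> Prop) :
  (forall s, P (\pi_tensor s)) -> forall u, P u.
Proof. by move=> h u; rewrite -[u]reprK. Qed.

Lemma taddA : associative tadd.
Proof.
by elim/tensor_pi_ind=> s; elim/tensor_pi_ind=> t; elim/tensor_pi_ind=> u;
  rewrite !tadd_pi catA.
Qed.

Lemma taddC : commutative tadd.
Proof.
elim/tensor_pi_ind=> s; elim/tensor_pi_ind=> t; rewrite !tadd_pi.
by apply/tensor_piP; exact: tc_catC.
Qed.

Lemma tadd0 : left_id tzero tadd.
Proof. by elim/tensor_pi_ind=> s; rewrite tadd_pi. Qed.

Lemma tcons z s : \pi_tensor (z :: s) = tadd (pure z.1 z.2) (\pi_tensor s).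
Proof. by case: z => x y; rewrite tadd_pi. Qed.

Lemma taddN : left_inverse tzero topp tadd.
Proof.
elim/tensor_pi_ind=> s; rewrite /topp tscale_pi.
elim: s => [|[x y] s IH]; first by rewrite tadd0.
rewrite map_cons !tcons /= [tadd (pure x y) _]taddC -taddA.
rewrite [tadd (\pi_tensor _) (tadd (\pi_tensor s) _)]taddA IH tadd0 tadd_pi /=.
apply/tensor_piP; apply: (tc_trans (tc_sym (tc_addl _ _ _))).
by rewrite scaleN1r addNr; exact: tc_zero.
Qed.

HB.instance Definition _ := GRing.isZmodule.Build tensor taddA taddC tadd0 taddN.

Lemma pureDl x x' y : pure (x + x') y = pure x y + pure x' y.
Proof. by rewrite [RHS]tadd_pi; apply/tensor_piP; exact: tc_addl. Qed.

Lemma pureDr x y y' : pure x (y + y') = pure x y + pure x y'.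
Proof. by rewrite [RHS]tadd_pi; apply/tensor_piP; exact: tc_addr. Qed.

Lemma pure_balanced a x y : pure (a *: x) y = pure x (a *: y).
Proof. by apply/tensor_piP; exact: tc_scale. Qed.

Lemma tensor_pi_sum s : \pi_tensor s = \sum_(z <- s) pure z.1 z.2.
Proof. by elim: s => [|z s IH]; rewrite ?big_nil // big_cons -IH tcons. Qed.

Lemma tensor_ind (P : tensor -> Prop) :
    P 0 -> (forall u v, P u -> P v -> P (u + v)) ->
    (forall x y, P (pure x y)) ->
  forall u, P u.
Proof.
move=> P0 PD Pp; elim/tensor_pi_ind => s; rewrite tensor_pi_sum.
by elim/big_ind: _.
Qed.

Lemma tscaleDr a : {morph tscale a : u v / u + v}.
Proof.
elim/tensor_pi_ind=> s; elim/tensor_pi_ind=> t.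
by rewrite [_ + _]tadd_pi !tscale_pi [RHS]tadd_pi map_cat.
Qed.

Lemma tscale_pure a x y : tscale a (pure x y) = pure (a *: x) y.
Proof. exact: tscale_pi. Qed.

Lemma tscale0 a : tscale a 0 = 0.
Proof. exact: tscale_pi. Qed.

Lemma tscaleA a b u : tscale a (tscale b u) = tscale (a * b) u.
Proof.
elim/tensor_ind: u => [|u v IHu IHv|x y]; first by rewrite !tscale0.
- by rewrite !tscaleDr IHu IHv.
- by rewrite !tscale_pure scalerA.
Qed.

Lemma tscale1 : left_id 1 tscale.
Proof.
elim/tensor_ind=> [|u v IHu IHv|x y]; first by rewrite tscale0.
- by rewrite tscaleDr IHu IHv.
- by rewrite tscale_pure scale1r.
Qed.

Lemma tscaleDl u : {morph tscale^~ u : a b / a + b}.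
Proof.
move=> a b; elim/tensor_ind: u => [|u v IHu IHv|x y].
- by rewrite !tscale0 addr0.
- by rewrite !tscaleDr IHu IHv addrACA.
- by rewrite !tscale_pure scalerDl pureDl.
Qed.

HB.instance Definition _ := GRing.Zmodule_isLmodule.Build R tensor
  tscaleA tscale1 tscaleDr tscaleDl.

Lemma pureZl a x y : pure (a *: x) y = a *: pure x y.
Proof. by rewrite -tscale_pure. Qed.

Lemma pureZr a x y : pure x (a *: y) = a *: pure x y.
Proof. by rewrite -pure_balanced pureZl. Qed.

Lemma pure0l y : pure 0 y = 0.
Proof. by rewrite -(scale0r 0) pureZl scale0r. Qed.

Lemma pure0r x : pure x 0 = 0.
Proof. by rewrite -(scale0r 0) pureZr scale0r. Qed.

Section Lift.
Variable U : zmodType.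

Definition balanced (f : M -> N -> U) : Prop :=
  [/\ forall x x' y, f (x + x') y = f x y + f x' y,
      forall x y y', f x (y + y') = f x y + f x y' &
      forall a x y, f (a *: x) y = f x (a *: y)].

(* The additive map induced by a balanced [f] (meaningless otherwise). *)
Definition tlift (f : M -> N -> U) (u : tensor) : U :=
  \sum_(z <- repr u) f z.1 z.2.

Variables (f : M -> N -> U) (hf : balanced f).

Lemma tlift_pi s : tlift f (\pi_tensor s) = \sum_(z <- s) f z.1 z.2.
Proof.
case: hf => fDl fDr fZ; rewrite /tlift.
move: (tensor_reprP s); move: (repr _) => s'; elim=> {s s'} //=.
- by move=> s t u _ -> _ ->.
- by move=> s s' t t' _ e1 _ e2; rewrite !big_cat /= e1 e2.
- by move=> s t; rewrite !big_cat /= addrC.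
- by move=> *; rewrite !big_cons !big_nil !addr0 /= fDl.
- by move=> *; rewrite !big_cons !big_nil !addr0 /= fDr.
- by move=> *; rewrite !big_cons !big_nil !addr0 /= fZ.
- move=> y; rewrite big_cons !big_nil /= addr0.
  by apply: (addrI (f 0 y)); rewrite -fDl !addr0.
Qed.

Lemma tliftE x y : tlift f (pure x y) = f x y.
Proof. by rewrite tlift_pi big_cons big_nil addr0. Qed.

Lemma tlift0 : tlift f 0 = 0.
Proof. by rewrite tlift_pi big_nil. Qed.

Lemma tliftD : {morph tlift f : u v / u + v}.
Proof.
elim/tensor_pi_ind=> s; elim/tensor_pi_ind=> t.
by rewrite [_ + _]tadd_pi !tlift_pi big_cat.
Qed.

End Lift.

Lemma tliftZ (U : lmodType R) (f : M -> N -> U) : balanced f ->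
  (forall a x y, f (a *: x) y = a *: f x y) ->
  forall a u, tlift f (a *: u) = a *: tlift f u.
Proof.
move=> hf fZ a u; elim/tensor_ind: u => [|u v IHu IHv|x y].
- by rewrite scaler0 tlift0 // scaler0.
- by rewrite scalerDr !tliftD // IHu IHv scalerDr.
- by rewrite -pureZl !tliftE // fZ.
Qed.

End TensorProduct.

Notation "M ⊗ N" := (tensor M N) (at level 40, left associativity) : type_scope.

Section TensorMaps.
Variable R : comNzRingType.

Definition tmap (M N M' N' : lmodType R) (f : M -> M') (g : N -> N') :
  M ⊗ N -> M' ⊗ N' := tlift (fun x y => pure (f x) (g y)).

Definition tswap (M N : lmodType R) : M ⊗ N -> N ⊗ M :=
  tlift (fun x y => pure y x).

Definition tassoc (M N P : lmodType R) : M ⊗ N ⊗ P -> M ⊗ (N ⊗ P) :=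
  tlift (fun u z => tlift (fun x y => pure x (pure y z)) u).

End TensorMaps.

Lemma tmap_balanced (R : comNzRingType) (M N M' N' : lmodType R)
    (f : {linear M -> M'}) (g : {linear N -> N'}) :
  balanced (fun x y => pure (f x) (g y)).
Proof.
split=> *; rewrite ?linearD ?linearZ /= ?pureDl ?pureDr //.
exact: pure_balanced.
Qed.

Lemma tassoc_balanced1 (R : comNzRingType) (M N P : lmodType R) (z : P) :
  balanced (fun (x : M) (y : N) => pure x (pure y z)).
Proof.
by split=> *; rewrite ?pureDl ?pureDr // pure_balanced pureZl.
Qed.

Lemma tassoc_balanced (R : comNzRingType) (M N P : lmodType R) :
  balanced (fun (u : M ⊗ N) (z : P) =>
    tlift (fun x y => pure x (pure y z)) u).
Proof.
split=> [u v z|u y z|a u z].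
- by rewrite tliftD //; exact: tassoc_balanced1.
- elim/tensor_ind: u => [|u v IHu IHv|x' y'].
  + by rewrite !tlift0 ?addr0 //; exact: tassoc_balanced1.
  + rewrite !tliftD; try exact: tassoc_balanced1.
    by rewrite IHu IHv addrACA.
  + rewrite !tliftE; try exact: tassoc_balanced1.
    by rewrite !pureDr.
- elim/tensor_ind: u => [|u v IHu IHv|x' y'].
  + by rewrite scaler0 !tlift0 //; exact: tassoc_balanced1.
  + rewrite scalerDr !tliftD; try exact: tassoc_balanced1.
    by rewrite IHu IHv.
  + rewrite -pureZl !tliftE; try exact: tassoc_balanced1.
    by rewrite pure_balanced -pureZl pure_balanced.
Qed.

(* (x ⊗ y)(x' ⊗ y') = xx' ⊗ yy' *)
Section TensorAlgebra.
Variables (R : comNzRingType) (A B : algType R).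

Definition tmul (u v : A ⊗ B) : A ⊗ B :=
  tlift (fun x y => tlift (fun x' y' => pure (x * x') (y * y')) v) u.

Let bal1 (x : A) (y : B) : balanced (fun x' y' => pure (x * x') (y * y')).
Proof.
split=> *; rewrite ?mulrDr ?pureDl ?pureDr //.
by rewrite -!scalerAr pure_balanced.
Qed.

Let bal2 v :
  balanced (fun (x : A) (y : B) => tlift (fun x' y' => pure (x * x') (y * y')) v).
Proof.
split.
- move=> x x' y; elim/tensor_ind: v => [|u v IHu IHv|x1 y1].
  + by rewrite !tlift0 // addr0.
  + by rewrite !tliftD // IHu IHv addrACA.
  + by rewrite !tliftE // mulrDl pureDl.
- move=> x y y'; elim/tensor_ind: v => [|u v IHu IHv|x1 y1].
  + by rewrite !tlift0 // addr0.
  + by rewrite !tliftD // IHu IHv addrACA.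
  + by rewrite !tliftE // mulrDl pureDr.
- move=> a x y; elim/tensor_ind: v => [|u v IHu IHv|x1 y1].
  + by rewrite !tlift0.
  + by rewrite !tliftD // IHu IHv.
  + by rewrite !tliftE // -!scalerAl pure_balanced.
Qed.

Lemma tmul_pure x y x' y' :
  tmul (pure x y) (pure x' y') = pure (x * x') (y * y').
Proof. by rewrite /tmul !tliftE. Qed.

Lemma tmulDl : left_distributive tmul +%R.
Proof. by move=> u v w; rewrite /tmul tliftD. Qed.

Lemma tmulDr : right_distributive tmul +%R.
Proof.
move=> u v w; elim/tensor_ind: u => [|u u' IHu IHu'|x y].
- by rewrite /tmul !tlift0 // addr0.
- by rewrite !tmulDl IHu IHu' addrACA.
- by rewrite /tmul !tliftE // tliftD.
Qed.

Lemma tmul0l u : tmul 0 u = 0.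
Proof. by rewrite /tmul tlift0. Qed.

Lemma tmul0r u : tmul u 0 = 0.
Proof. by apply: (addrI (tmul u 0)); rewrite -tmulDr !addr0. Qed.

Lemma tmulA : associative tmul.
Proof.
move=> u v w; elim/tensor_ind: u => [|u u' IHu IHu'|x y].
- by rewrite !tmul0l.
- by rewrite !tmulDl IHu IHu'.
elim/tensor_ind: v => [|u u' IHu IHu'|x' y'].
- by rewrite !(tmul0l, tmul0r).
- by rewrite !(tmulDl, tmulDr) IHu IHu'.
elim/tensor_ind: w => [|u u' IHu IHu'|x'' y''].
- by rewrite !tmul0r.
- by rewrite !tmulDr IHu IHu'.
- by rewrite !tmul_pure !mulrA.
Qed.

Lemma tmul1l : left_id (pure 1 1) tmul.
Proof.
elim/tensor_ind=> [|u u' IHu IHu'|x y]; first by rewrite tmul0r.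
- by rewrite tmulDr IHu IHu'.
- by rewrite tmul_pure !mul1r.
Qed.

Lemma tmul1r : right_id (pure 1 1) tmul.
Proof.
elim/tensor_ind=> [|u u' IHu IHu'|x y]; first by rewrite tmul0l.
- by rewrite tmulDl IHu IHu'.
- by rewrite tmul_pure !mulr1.
Qed.

HB.instance Definition _ := GRing.Zmodule_isPzRing.Build (A ⊗ B)
  tmulA tmul1l tmul1r tmulDl tmulDr.

End TensorAlgebra.

Record coalgebra (R : comNzRingType) (C : lmodType R) := Coalgebra {
  comul : {linear C -> C ⊗ C};
  counit : {linear C -> R^o};
  coassoc : forall c : C,
    tassoc (tmap comul idfun (comul c)) = tmap idfun comul (comul c);
  counitl : forall c : C, tlift (fun x y => counit x *: y) (comul c) = c;
  counitr : forall c : C, tlift (fun x y => counit y *: x) (comul c) = c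
}.

Lemma counit_balancedl (R : comNzRingType) (C : lmodType R)
    (e : {linear C -> R^o}) : balanced (fun x y : C => e x *: y).
Proof.
split=> *; rewrite ?linearD ?linearZ /= ?scalerDl ?scalerDr //.
by rewrite scalerA mulrC -scalerA scalerA mulrC.
Qed.

Lemma counit_balancedr (R : comNzRingType) (C : lmodType R)
    (e : {linear C -> R^o}) : balanced (fun x y : C => e y *: x).
Proof.
split=> *; rewrite ?linearD ?linearZ /= ?scalerDl ?scalerDr //.
by rewrite scalerA.
Qed.

Definition cocommutative (R : comNzRingType) (C : lmodType R)
    (D : coalgebra C) : Prop :=
  forall c : C, tswap (comul D c) = comul D c.

Definition is_bialgebra (R : comNzRingType) (H : algType R)
    (D : coalgebra H) : Prop :=
  monoid_morphism (comul D) /\ monoid_morphism (counit D : H -> R).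

Section DualAlgebra.
Variables (R : comNzRingType) (C : lmodType R) (D : coalgebra C).

Definition conv_fun (f g : {linear C -> R^o}) (c : C) : R^o :=
  tlift (fun x y => f x * g y : R^o) (comul D c).

Lemma conv_balanced (f g : {linear C -> R^o}) :
  balanced (fun x y => f x * g y : R^o).
Proof.
split=> [x x' y|x y y'|a x y].
- by rewrite linearD mulrDl.
- by rewrite linearD mulrDr.
- by rewrite !linearZ /= -[a *: f x]/(a * f x) -[a *: g y]/(a * g y) mulrCA mulrA.
Qed.

Lemma conv_fun_linear f g : linear (conv_fun f g).
Proof.
move=> a u v; rewrite /conv_fun linearD linearZ /=.
have hb := conv_balanced f g.
rewrite tliftD // tliftZ // => b x y.
by rewrite linearZ /= -[b *: f x]/(b * f x) -mulrA.
Qed.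

HB.instance Definition _ f g := GRing.isLinear.Build R C R^o _ (conv_fun f g)
  (conv_fun_linear f g).

(* The product of the dual algebra C^*; its unit is the counit. *)
Definition conv (f g : {linear C -> R^o}) : {linear C -> R^o} := conv_fun f g.

Definition conv_exp (f : {linear C -> R^o}) (n : nat) : {linear C -> R^o} :=
  iter n (conv f) (counit D).

End DualAlgebra.

Definition is_shift (p : nat) (C : lmodType 'F_p) (D : coalgebra C)
    (V : {linear C -> C}) : Prop :=
  forall (f : {linear C -> ('F_p)^o}) (c : C), f (V c) = conv_exp D f p c.

Section MultipleSubgroup.
Variables (H : zmodType) (p : nat).

Definition multiples : {pred H} := fun x => `[< exists y, x = y *+ p >].

Lemma multiplesP x : reflect (exists y, x = y *+ p) (x \in multiples).
Proof. exact: asboolP. Qed.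

Lemma multiples_zmod_closed : zmod_closed multiples.
Proof.
split=> [|x y /multiplesP[x' ->] /multiplesP[y' ->]]; apply/multiplesP.
- by exists 0; rewrite mul0rn.
- by exists (x' - y'); rewrite mulrnBl.
Qed.

HB.instance Definition _ := GRing.isZmodClosed.Build H multiples
  multiples_zmod_closed.

End MultipleSubgroup.

Arguments multiples : clear implicits.

Section Reduction.
(* H/pH; the primality proof lets it carry its F_p-module structure. *)
Definition reduction (p : nat) (_ : prime p) (H : zmodType) :=
  Quotient.quot (multiples H p).

Variables (p : nat) (hp : prime p).

Section Module.
Variable H : zmodType.
HB.instance Definition _ := GRing.Zmodule.on (reduction hp H).
HB.instance Definition _ := EqQuotient.on (reduction hp H).

Local Notation Hp := (reduction hp H).

Definition red (x : H) : Hp := \pi x.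

Lemma red_is_zmod_morphism : zmod_morphism red.
Proof. exact: (raddfB (\pi_(Quotient.quot (multiples H p)))). Qed.

HB.instance Definition _ := GRing.isZmodMorphism.Build H Hp red
  red_is_zmod_morphism.

Lemma redK (c : Hp) : red (repr c) = c.
Proof. exact: reprK. Qed.

Lemma redP x y : red x = red y <-> exists z, x - y = z *+ p.
Proof.
split=> [h|/multiplesP].
- by apply/multiplesP; rewrite Quotient.idealrBE; apply/eqP.
- by rewrite Quotient.idealrBE => /eqP.
Qed.

Lemma red_p (c : Hp) : c *+ p = 0.
Proof.
rewrite -[c]redK -raddfMn -[RHS](raddf0 red).
by apply/redP; exists (repr c); rewrite subr0.
Qed.

Lemma red_modp (c : Hp) n : c *+ (n %% (Zp_trunc (pdiv p)).+2) = c *+ n.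
Proof.
rewrite Fp_cast //.
by rewrite [in RHS](divn_eq n p) mulrnDr mulnC mulrnA red_p mul0rn add0r.
Qed.

Definition rscale (a : 'F_p) (c : Hp) : Hp := c *+ a.

Lemma rscaleA a b c : rscale a (rscale b c) = rscale (a * b) c.
Proof. by rewrite /rscale /= red_modp mulnC mulrnA. Qed.

Lemma rscale1 : left_id 1 rscale.
Proof. by move=> c; rewrite /rscale /= red_modp. Qed.

Lemma rscaleDr : right_distributive rscale +%R.
Proof. by move=> a c d; rewrite /rscale mulrnDl. Qed.

Lemma rscaleDl c : {morph rscale^~ c : a b / a + b}.
Proof. by move=> a b; rewrite /rscale /= red_modp mulrnDr. Qed.

HB.instance Definition _ := GRing.Zmodule_isLmodule.Build 'F_p Hp
  rscaleA rscale1 rscaleDr rscaleDl.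

Lemma Fp_scaleE (U : lmodType 'F_p) (a : 'F_p) (u : U) : a *: u = u *+ (a : nat).
Proof. by rewrite -scaler_nat natr_Zp. Qed.

Lemma red_ind (P : Hp -> Prop) : (forall x, P (red x)) -> forall c, P c.
Proof. by move=> h c; rewrite -[c]redK. Qed.

End Module.

Section Coalgebra.
Variables (H : lmodType int) (D : coalgebra H).
Local Notation Hp := (reduction hp H).

Lemma redZ (a : int) (x : H) : red (a *: x) = (a%:~R : 'F_p) *: red x.
Proof. by rewrite -{1}[a]intz scaler_int raddfMz scaler_int. Qed.

Lemma red2_balanced : balanced (fun x y : H => pure (red x) (red y)).
Proof.
split=> *; rewrite ?raddfD /= ?pureDl ?pureDr //.
by rewrite !redZ pure_balanced.
Qed.

(* H ⊗ H -> H/pH ⊗ H/pH *)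
Definition red2 : H ⊗ H -> Hp ⊗ Hp := tlift (fun x y => pure (red x) (red y)).

Lemma red2_is_zmod_morphism : zmod_morphism red2.
Proof.
have hD : {morph red2 : u v / u + v} by exact: tliftD red2_balanced.
move=> u v; apply: (addIr (red2 v)).
by rewrite -hD !subrK.
Qed.

HB.instance Definition _ := GRing.isZmodMorphism.Build (H ⊗ H) (Hp ⊗ Hp) red2
  red2_is_zmod_morphism.

Definition rcomul (c : Hp) : Hp ⊗ Hp := red2 (comul D (repr c)).

Lemma rcomul_red x : rcomul (red x) = red2 (comul D x).
Proof.
rewrite /rcomul; have /redP[z] := redK (red x).
move=> e; apply/eqP; rewrite -subr_eq0 -!raddfB e !raddfMn.
by rewrite -scaler_nat pchar_Fp_0 ?scale0r.
Qed.

Lemma rcomul_linear : linear rcomul.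
Proof.
move=> a; elim/red_ind=> x; elim/red_ind=> y.
rewrite !Fp_scaleE -raddfMn -raddfD !rcomul_red.
by rewrite !raddfD !raddfMn.
Qed.

HB.instance Definition _ := GRing.isLinear.Build 'F_p Hp (Hp ⊗ Hp) _ rcomul
  rcomul_linear.

Definition rcounit (c : Hp) : ('F_p)^o := (counit D (repr c) : int)%:~R.

Lemma rcounit_red x : rcounit (red x) = (counit D x : int)%:~R.
Proof.
rewrite /rcounit; have /redP[z] := redK (red x).
move=> e; apply/eqP; rewrite -subr_eq0 -rmorphB -raddfB e raddfMn rmorphMn.
by rewrite -mulr_natr pchar_Fp_0 ?mulr0.
Qed.

Lemma rcounit_linear : linear rcounit.
Proof.
move=> a; elim/red_ind=> x; elim/red_ind=> y.
rewrite !Fp_scaleE -raddfMn -raddfD !rcounit_red.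
by rewrite !raddfD !raddfMn.
Qed.

HB.instance Definition _ := GRing.isLinear.Build 'F_p Hp ('F_p)^o _ rcounit
  rcounit_linear.

Lemma red2_pure x y : red2 (pure x y) = pure (red x) (red y).
Proof. exact: tliftE red2_balanced _ _. Qed.

Definition red3 : H ⊗ (H ⊗ H) -> Hp ⊗ (Hp ⊗ Hp) :=
  tlift (fun x v => pure (red x) (red2 v)).

Lemma red3_balanced : balanced (fun (x : H) (v : H ⊗ H) => pure (red x) (red2 v)).
Proof.
split=> [x x' v|x v v'|a x v]; rewrite ?raddfD /= ?pureDl ?pureDr //.
rewrite redZ pure_balanced; congr pure.
elim/tensor_ind: v => [|v v' IHv IHv'|y z].
- by rewrite !(raddf0, scaler0).
- by rewrite [a *: (v + v')]scalerDr !raddfD /= IHv IHv'.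
- by rewrite -pureZl !red2_pure redZ pureZl.
Qed.

Lemma rcoassocl u :
  tassoc (tmap (rcomul : {linear Hp -> Hp ⊗ Hp}) idfun (red2 u)) =
  red3 (tassoc (tmap (comul D) idfun u)).
Proof.
have bt := @tmap_balanced.
have ba := @tassoc_balanced.
have br := red3_balanced.
elim/tensor_ind: u => [|u v IHu IHv|x y].
- rewrite raddf0 /tmap (tlift0 (bt _ _ _ _ _ _ idfun)) /=.
  rewrite (tlift0 (bt _ _ _ _ _ (comul D) idfun)).
  by rewrite /tassoc !(tlift0 (ba _ _ _ _)) /red3 (tlift0 br).
- rewrite raddfD /tmap (tliftD (bt _ _ _ _ _ _ idfun)) /=.
  rewrite (tliftD (bt _ _ _ _ _ (comul D) idfun)).
  rewrite /tassoc !(tliftD (ba _ _ _ _)) /red3 (tliftD br).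
  by congr (_ + _); [exact: IHu | exact: IHv].
rewrite red2_pure /tmap (tliftE (bt _ _ _ _ _ _ idfun)) /=.
rewrite (tliftE (bt _ _ _ _ _ (comul D) idfun)) /= rcomul_red.
rewrite /tassoc !(tliftE (ba _ _ _ _)).
have b1 := @tassoc_balanced1.
elim/tensor_ind: (comul D x) => [|u v IHu IHv|x1 x2].
- by rewrite raddf0 !(tlift0 (b1 _ _ _ _ _)) /red3 (tlift0 br).
- rewrite raddfD !(tliftD (b1 _ _ _ _ _)) /red3 (tliftD br).
  by congr (_ + _); [exact: IHu | exact: IHv].
rewrite red2_pure !(tliftE (b1 _ _ _ _ _)) /red3 (tliftE br).
by rewrite red2_pure.
Qed.

Lemma rcoassocr u :
  tmap idfun (rcomul : {linear Hp -> Hp ⊗ Hp}) (red2 u) =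
  red3 (tmap idfun (comul D) u).
Proof.
have bt := @tmap_balanced.
have br := red3_balanced.
elim/tensor_ind: u => [|u v IHu IHv|x y].
- rewrite raddf0 /tmap (tlift0 (bt _ _ _ _ _ idfun _)) /=.
  rewrite (tlift0 (bt _ _ _ _ _ idfun (comul D))).
  by rewrite /red3 (tlift0 br).
- rewrite raddfD /tmap (tliftD (bt _ _ _ _ _ idfun _)) /=.
  rewrite (tliftD (bt _ _ _ _ _ idfun (comul D))) /red3 (tliftD br).
  by congr (_ + _); [exact: IHu | exact: IHv].
rewrite red2_pure /tmap (tliftE (bt _ _ _ _ _ idfun _)) /=.
rewrite (tliftE (bt _ _ _ _ _ idfun (comul D))) /= rcomul_red.
by rewrite /red3 (tliftE br).
Qed.

Lemma rcoassoc (c : Hp) :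
  tassoc (tmap rcomul idfun (rcomul c)) = tmap idfun rcomul (rcomul c).
Proof.
elim/red_ind: c => x.
by rewrite rcomul_red rcoassocl rcoassocr coassoc.
Qed.

Lemma rcounitl (c : Hp) : tlift (fun x y => rcounit x *: y) (rcomul c) = c.
Proof.
elim/red_ind: c => x; rewrite rcomul_red -[in RHS](counitl D x).
have bl := counit_balancedl (counit D).
have br := counit_balancedl (rcounit : {linear Hp -> ('F_p)^o}).
elim/tensor_ind: (comul D x) => [|u v IHu IHv|y z].
- by rewrite raddf0 (tlift0 br) (tlift0 bl) raddf0.
- by rewrite raddfD (tliftD br) (tliftD bl) raddfD /= IHu IHv.
- by rewrite red2_pure (tliftE br) (tliftE bl) /= rcounit_red redZ.
Qed.

Lemma rcounitr (c : Hp) : tlift (fun x y => rcounit y *: x) (rcomul c) = c.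
Proof.
elim/red_ind: c => x; rewrite rcomul_red -[in RHS](counitr D x).
have bl := counit_balancedr (counit D).
have br := counit_balancedr (rcounit : {linear Hp -> ('F_p)^o}).
elim/tensor_ind: (comul D x) => [|u v IHu IHv|y z].
- by rewrite raddf0 (tlift0 br) (tlift0 bl) raddf0.
- by rewrite raddfD (tliftD br) (tliftD bl) raddfD /= IHu IHv.
- by rewrite red2_pure (tliftE br) (tliftE bl) /= rcounit_red redZ.
Qed.

(* The F_p-coalgebra H/pH *)
Definition reduction_coalgebra : coalgebra Hp :=
  @Coalgebra _ Hp rcomul rcounit rcoassoc rcounitl rcounitr.

End Coalgebra.

End Reduction.

(* H is the internal direct sum of the subgroups [G n]. *)
Definition is_grading (R : comNzRingType) (H : lmodType R)
    (G : nat -> set H) : Prop :=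
  [/\ forall n, G n 0 /\ (forall (a : R) x y, G n x -> G n y -> G n (a *: x + y)),
      forall x, exists N (h : nat -> H),
        (forall i, G i (h i)) /\ x = \sum_(i < N) h i &
      forall N (h : nat -> H), (forall i, G i (h i)) ->
        \sum_(i < N) h i = 0 -> forall i, (i < N)%N -> h i = 0].

(* The degree n part of the total grading of H ⊗ H *)
Definition tensor_grading (R : comNzRingType) (H : lmodType R)
    (G : nat -> set H) (n : nat) : set (H ⊗ H) :=
  [set u | exists s : seq (H * H),
    (forall z, z \in s -> exists i j, [/\ (i + j)%N = n, G i z.1 & G j z.2]) /\
    u = \sum_(z <- s) pure z.1 z.2]%classic.

(* The symmetry of H ⊗ H used in [cocommutative], and its product, involve no
   Koszul signs. *)
Definition is_graded_bialgebra (R : comNzRingType) (H : algType R)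
    (D : coalgebra H) (G : nat -> set H) : Prop :=
  [/\ is_bialgebra D /\ is_grading G,
      G 0%N 1,
      forall m n x y, G m x -> G n y -> G (m + n)%N (x * y),
      forall n x, G n x -> tensor_grading G n (comul D x) &
      forall n x, (0 < n)%N -> G n x -> counit D x = 0].

Definition fg_free (R : comNzRingType) (H : lmodType R) (A : set H) : Prop :=
  exists d (e : 'I_d -> H),
    A = [set x | exists c : 'I_d -> R, x = \sum_i c i *: e i]%classic /\
    (forall c : 'I_d -> R, \sum_i c i *: e i = 0 -> forall i, c i = 0).

Definition primitive (R : comNzRingType) (H : algType R) (D : coalgebra H)
    (a : H) : Prop :=
  comul D a = pure a 1 + pure 1 a.

Definition liftable (R : comNzRingType) (H : algType R) (D : coalgebra H)
    (a1 : H) : Prop :=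
  exists a : nat -> H, [/\ a 0%N = 1, a 1%N = a1 &
    forall n, comul D (a n) = \sum_(m < n.+1) pure (a m) (a (n - m)%N)].

(* Main.v *)
Require Import Defs.
From HB Require Import structures.
From mathcomp Require Import all_boot all_order all_algebra.
From mathcomp Require Import boolp classical_sets.
From mathcomp Require Import zify.

Set Implicit Arguments.
Unset Strict Implicit.
Unset Printing Implicit Defensive.

Import GRing.Theory.
Local Open Scope ring_scope.

(** The graded dual of [H] is a commutative algebra under convolution, and
    surjectivity of the shifts says that it is reduced modulo every prime; in
    effect it is then a polynomial ring over Z, and a primitive element of [H] is
    a linear function on its indecomposables, which extends to an algebra map to
    Z[t], that is, to a divided power sequence.

    Concretely, induct on the degree [n].  Lift a basis of the primitives of
    degree < n to divided power sequences [X i] up to degree < n.  The ordered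
    products [x_b] of their terms form a basis in degrees < n, dual to the
    monomials [xi^a] in the functionals [xi i] dual to the basis primitives.  For
    [z] of degree [n] the reduced coproduct of [z] is determined by the integers
    [xi^c (z)], [deg c = n], so that the next term of [X j] exists as soon as
    these integers can be prescribed arbitrarily.  Let [S] be the lattice of the
    attained values.  Products [x_b] show that [S] contains the unit vector of
    every monomial which is not a pure power, products [X i (m-1) * X i 1] give
    [m] times the unit vector of [xi i ^ m], and since
    [xi^(p c) (z) = xi^c (V z)] mod [p], surjectivity of [V] gives modulo [p] the
    unit vectors of the [p]-th powers.  So [S] has finite index and is full modulo
    every prime. *)

(** * The convolution algebra *)

(** Convolution can be registered as a monoid law only if its identities are equalities of bundled
    maps, so the proofs of linearity have to be identified as well. *)
Lemma linear_ext (R : pzRingType) (U V : lmodType R) (f g : {linear U -> V}) :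
  f =1 g -> f = g.
Proof.
case: f g => [f cf] [g cg] /= /funext fg; subst g; congr GRing.Linear.Pack.
case: cf cg => [[a] [b]] [[c] [d]].
by rewrite (Prop_irrelevance a c) (Prop_irrelevance b d).
Qed.

Section Convolution.
Variables (R : comNzRingType) (C : lmodType R) (D : coalgebra C).
Implicit Types f g h : {linear C -> R^o}.

Lemma functionalZ f a x : f (a *: x) = a * f x :> R.
Proof. by rewrite linearZ. Qed.

Lemma convE f g c : conv D f g c = tlift (fun x y => f x * g y : R^o) (comul D c).
Proof. by []. Qed.

Let triple_balanced f g h :
  balanced (fun (x : C) (v : C ⊗ C) => f x * tlift (fun y z => g y * h z : R^o) v : R^o).
Proof.
have b := conv_balanced.
split=> [x x' v|x v v'|a x v].
- by rewrite linearD mulrDl.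
- by rewrite tliftD // mulrDr.
- rewrite functionalZ (tliftZ (U := R^o)) //; last first.
    by move=> k y z; rewrite functionalZ -mulrA.
  by rewrite -[RHS]/(f x * (a * _)) mulrCA mulrA.
Qed.

(** Both sides are the trilinear form [T], evaluated at the two sides of [coassoc]. *)
Lemma convA : associative (conv D).
Proof.
move=> f g h; apply: linear_ext => c; rewrite /= /conv_fun.
set T := tlift (fun x v => f x * tlift (fun y z => g y * h z : R^o) v : R^o).
have b := conv_balanced; have bT := triple_balanced f g h.
have bt := @tmap_balanced; have ba := @tassoc_balanced.
have b1 := @tassoc_balanced1.
have -> : tlift (fun x y => f x * conv D g h y : R^o) (comul D c) =
    T (tmap idfun (comul D) (comul D c)).
  elim/tensor_ind: (comul D c) => [|u v IHu IHv|x y].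
  - by rewrite /T /tmap (tlift0 (bt _ _ _ _ _ idfun _)) !tlift0.
  - by rewrite /T /tmap (tliftD (bt _ _ _ _ _ idfun _)) !tliftD // IHu IHv.
  - by rewrite /T /tmap (tliftE (bt _ _ _ _ _ idfun _)) !tliftE.
rewrite -coassoc.
elim/tensor_ind: (comul D c) => [|u v IHu IHv|x y].
- rewrite /T /tmap (tlift0 (bt _ _ _ _ _ _ idfun)) /tassoc (tlift0 (ba _ _ _ _)).
  by rewrite !tlift0.
- rewrite /T /tmap (tliftD (bt _ _ _ _ _ _ idfun)) /tassoc (tliftD (ba _ _ _ _)).
  by rewrite !tliftD // -IHu -IHv.
rewrite /T /tmap (tliftE (bt _ _ _ _ _ _ idfun)) /tassoc (tliftE (ba _ _ _ _)).
rewrite tliftE //= convE.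
elim/tensor_ind: (comul D x) => [|u v IHu IHv|x1 x2].
- by rewrite (tlift0 (b1 _ _ _ _ _)) !tlift0 // mul0r.
- by rewrite (tliftD (b1 _ _ _ _ _)) !tliftD // mulrDl IHu IHv.
- by rewrite (tliftE (b1 _ _ _ _ _)) !tliftE // mulrA.
Qed.

Lemma conv1l : left_id (counit D) (conv D).
Proof.
move=> f; apply: linear_ext => c.
rewrite -[in RHS](counitl D c) convE.
have bl := counit_balancedl (counit D); have b := conv_balanced.
elim/tensor_ind: (comul D c) => [|u v IHu IHv|x1 x2].
- by rewrite !tlift0 // linear0.
- by rewrite !tliftD // linearD IHu IHv.
- by rewrite !tliftE // linearZ.
Qed.

Lemma convC : cocommutative D -> commutative (conv D).
Proof.
move=> cocomm f g; apply: linear_ext => c.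
rewrite !convE -[in LHS]cocomm.
have b := conv_balanced.
have bs : balanced (fun x y : C => pure y x).
  by split=> *; rewrite ?pureDl ?pureDr // pure_balanced.
elim/tensor_ind: (comul D c) => [|u v IHu IHv|x1 x2].
- by rewrite /tswap (tlift0 bs) !tlift0.
- by rewrite /tswap (tliftD bs) !tliftD // IHu IHv.
- by rewrite /tswap (tliftE bs) !tliftE // mulrC.
Qed.

Lemma conv_exp0 f : conv_exp D f 0 = counit D.
Proof. by []. Qed.

Lemma conv_expS f n : conv_exp D f n.+1 = conv D f (conv_exp D f n).
Proof. by []. Qed.

Lemma conv_expD f m n :
  conv_exp D f (m + n) = conv D (conv_exp D f m) (conv_exp D f n).
Proof.
elim: m => [|m IH]; first by rewrite conv1l.
by rewrite addSn !conv_expS IH convA.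
Qed.

End Convolution.

Section ReductionDual.
Variables (p : nat) (hp : prime p) (H : lmodType int) (D : coalgebra H).
Local Notation Hp := (reduction hp H).
Implicit Types f g : {linear H -> int^o}.

(** The functional induced modulo [p]; by [rdual_red] the choice of representative is immaterial. *)
Definition rdual f (c : Hp) : ('F_p)^o := (f (repr c) : int)%:~R.

Lemma rdual_red f x : rdual f (red hp x) = (f x : int)%:~R.
Proof.
rewrite /rdual; have /redP[z] := redK (red hp x).
move=> e; apply/eqP; rewrite -subr_eq0 -rmorphB -raddfB e raddfMn rmorphMn.
by rewrite -mulr_natr pchar_Fp_0 ?mulr0.
Qed.

Lemma rdual_linear f : linear (rdual f).
Proof.
move=> a; elim/red_ind=> x; elim/red_ind=> y.
rewrite !Fp_scaleE -raddfMn -raddfD !rdual_red.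
by rewrite !raddfD !raddfMn.
Qed.

HB.instance Definition _ f := GRing.isLinear.Build 'F_p Hp ('F_p)^o _ (rdual f)
  (rdual_linear f).

(** This lets the shift, which is characterized by functionals modulo [p], be tested on integral
    functionals. *)
Lemma conv_exp_rdual f n x :
  conv_exp (reduction_coalgebra hp D) (rdual f) n (red hp x) =
  (conv_exp D f n x : int)%:~R.
Proof.
elim: n x => [|n IH] x; first by rewrite /= rcounit_red.
rewrite !conv_expS !convE /= rcomul_red.
have b := conv_balanced.
elim/tensor_ind: (comul D x) => [|u v IHu IHv|x1 x2].
- by rewrite raddf0 !tlift0 //; exact: b.
- rewrite raddfD !tliftD; try exact: b.
  by apply: etrans (congr2 +%R IHu IHv) _; exact: esym (intrD _ _ _).
- rewrite red2_pure !tliftE; try exact: b.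
  by rewrite IH /= rdual_red; exact: esym (intrM _ _ _).
Qed.

End ReductionDual.

(** * Subgroups of abelian groups *)

Lemma subgroup_muln (L : zmodType) (S : L -> Prop) :
  S 0 -> (forall x y, S x -> S y -> S (x - y)) ->
  forall n x, S x -> S (x *+ n).
Proof.
move=> S0 SB n x Sx; elim: n => [|n IH]; first by rewrite mulr0n.
by rewrite mulrS -[x *+ n]opprK; apply: (SB) => //; rewrite -sub0r; apply: (SB).
Qed.

Lemma subgroup_mulz (L : zmodType) (S : L -> Prop) :
  S 0 -> (forall x y, S x -> S y -> S (x - y)) ->
  forall (k : int) x, S x -> S (x *~ k).
Proof.
move=> S0 SB [n|n] x Sx; first exact: (subgroup_muln S0 SB).
by rewrite NegzE mulrNz -sub0r; apply: (SB) => //; exact: (subgroup_muln S0 SB).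
Qed.

Lemma subgroup_sum (L : zmodType) (S : L -> Prop) (T : finType) (P : pred T) (F : T -> L) :
  S 0 -> (forall x y, S x -> S y -> S (x - y)) ->
  (forall t, P t -> S (F t)) -> S (\sum_(t | P t) F t).
Proof.
move=> S0 SB SF; elim/big_rec: _ => // t x Pt Sx.
by rewrite -[x]opprK; apply: (SB); [exact: SF|rewrite -sub0r; apply: (SB)].
Qed.

(* [S + N L = L] for all [N], by multiplicativity in [N]; then take [N = n]. *)
Lemma full_subgroup (L : zmodType) (S : L -> Prop) (n : nat) :
  S 0 -> (forall x y, S x -> S y -> S (x - y)) -> (0 < n)%N ->
  (forall x, S (x *+ n)) ->
  (forall p, prime p -> forall x, exists s y, S s /\ x = s + y *+ p) ->
  forall x, S x.
Proof.
move=> S0 SB n0 Sn Sp.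
have SD x y : S x -> S y -> S (x + y).
  by move=> Sx Sy; rewrite -[y]opprK; apply: (SB) => //; rewrite -sub0r; apply: (SB).
suff SN N : (0 < N)%N -> forall x, exists s y, S s /\ x = s + y *+ N.
  by move=> x; have [s [y [Ss ->]]] := SN n n0 x; apply: (SD).
have [m] := ubnP N; elim: m N => // m IH N Nm N0 x.
have [N1|N1] := leqP N 1.
  by exists 0, x; split=> //; rewrite add0r (_ : N = 1%N) //; apply/eqP; rewrite eqn_leq N1.
have pr := pdiv_prime N1; have dv := pdiv_dvd N.
set p := pdiv N in pr dv.
have [s [y [Ss ->]]] := Sp p pr x.
have [] := IH (N %/ p)%N _ _ y.
- by apply: leq_trans (ltn_Pdiv (prime_gt1 pr) N0) _; rewrite -ltnS.
- by rewrite divn_gt0 ?prime_gt0 // dvdn_leq.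
move=> s' [y' [Ss' ->]]; exists (s + s' *+ p), y'; split.
  by apply: (SD) => //; exact: (subgroup_muln S0 SB).
by rewrite mulrnDl addrA -mulrnA divnK.
Qed.

(** Induction on the rank: the first coordinates of elements of [P] form an ideal of the integers,
    and the kernel of the first coordinate lies in a lattice of smaller rank. An element above a
    generator of the ideal extends a basis of the kernel to one of [P]. *)
Lemma fg_free_sub (H : lmodType int) (A P : set H) :
  fg_free A -> (P `<=` A)%classic -> P 0 ->
  (forall x y, P x -> P y -> P (x - y)) -> fg_free P.
Proof.
move=> [d [e [-> ind]]]; elim: d e P ind => [|d IH] e P ind PA P0 PB.
  exists 0%N, e; split=> //; apply/seteqP; split=> [x /PA //|x [c ->]].
  by rewrite big_ord0.
pose e' i := e (lift ord0 i).
pose P' : set H := fun x => P x /\ exists c, x = \sum_i c i *: e' i.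
have ind' c : \sum_i c i *: e' i = 0 -> forall i, c i = 0.
  move=> s0 i; pose c1 j := oapp c 0 (unlift ord0 j).
  have := ind c1; rewrite big_ord_recl /c1 unlift_none /= scale0r add0r.
  under eq_bigr => j _ do rewrite liftK /=.
  by move=> /(_ s0) /(_ (lift ord0 i)); rewrite liftK.
have [] := IH e' P' ind'.
- by move=> x [].
- by split=> //; exists (fun=> 0); rewrite big1 // => i _; rewrite scale0r.
- move=> x y [Px [c xE]] [Py [c' yE]]; split; first exact: PB.
  by exists (fun i => c i - c' i); rewrite xE yE -sumrB; apply: eq_bigr => i _; rewrite scalerBl.
move=> r [b [defP' indb]].
pose Q (m : nat) := `[< (0 < m)%N /\ exists c, P (\sum_i c i *: e i) /\ c ord0 = m :> int >].
(* Without a positive first coordinate all of them vanish, since [P] is closed under multiplication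
   by the sign. *)
have [exQ|nQ] := pselect (exists m, Q m); last first.
  exists r, b; split=> //; rewrite -defP'; apply/seteqP; split=> [x Px|x []//].
  split=> //; have [c xE] := PA x Px; exists (fun i => c (lift ord0 i)).
  rewrite xE big_ord_recl; case: (eqVneq (c ord0) 0) => [->|c0]; first by rewrite scale0r add0r.
  case: nQ; exists `|c ord0|%N; apply/asboolP; split; first by rewrite absz_gt0.
  exists (fun i => c i * sgz (c ord0)); split; last by rewrite mulrC -abszEsg.
  have -> : \sum_i (c i * sgz (c ord0)) *: e i = x *~ sgz (c ord0).
    rewrite -scaler_int intz xE scaler_sumr; apply: eq_bigr => i _.
    by rewrite scalerA mulrC.
  exact: (subgroup_mulz P0 PB).
case: (ex_minnP exQ) => m /asboolP[m0 [c0 [Px0 c0m]]] minm.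
set x0 := \sum_i c0 i *: e i in Px0.
(* A nonzero remainder modulo [m] would be a smaller positive first coordinate. *)
have divP c : P (\sum_i c i *: e i) -> (m %| c ord0)%Z.
  move=> Px; apply/dvdz_mod0P; apply/eqP; case: eqVneq => // nz.
  have rpos : (0 <= c ord0 %% m)%Z by rewrite modz_ge0 // -lt0n.
  have rlt : (c ord0 %% m < m)%Z by rewrite ltz_pmod.
  have /minm : Q `|(c ord0 %% m)%Z|%N.
    apply/asboolP; split; first by rewrite absz_gt0.
    exists (fun i => c i - (c ord0 %/ m)%Z * c0 i); split; last first.
      by rewrite gez0_abs // c0m /modz.
    have -> : \sum_i (c i - (c ord0 %/ m)%Z * c0 i) *: e i =
              \sum_i c i *: e i - x0 *~ (c ord0 %/ m)%Z.
      rewrite -scaler_int intz scaler_sumr -sumrB; apply: eq_bigr => i _.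
      by rewrite scalerBl scalerA.
    by apply: (PB) => //; exact: (subgroup_mulz P0 PB).
  by rewrite leqNgt -ltz_nat gez0_abs ?rlt.
exists r.+1, (fun i => oapp b x0 (unlift ord0 i)).
have sumE c : \sum_(i < r.+1) c i *: oapp b x0 (unlift ord0 i) =
    c ord0 *: x0 + \sum_(i < r) c (lift ord0 i) *: b i.
  rewrite big_ord_recl unlift_none; congr (_ + _).
  by apply: eq_bigr => i _; rewrite liftK.
have Pb c : P' (\sum_(i < r) c i *: b i) by rewrite defP'; exists c.
split; last first.
  move=> c; rewrite sumE => s0.
  have [_ [c' bE]] := Pb (fun i => c (lift ord0 i)).
  have c00 : c ord0 = 0.
    have := ind (fun j => c ord0 * c0 j + oapp c' 0 (unlift ord0 j)).
    have -> : \sum_i (c ord0 * c0 i + oapp c' 0 (unlift ord0 i)) *: e i = 0.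
      rewrite -[RHS]s0 bE; under eq_bigr => i _ do rewrite scalerDl.
      rewrite big_split /= /x0 scaler_sumr; congr (_ + _).
        by apply: eq_bigr => i _; rewrite scalerA.
      rewrite big_ord_recl unlift_none scale0r add0r.
      by apply: eq_bigr => i _; rewrite liftK.
    move=> /(_ erefl ord0); rewrite unlift_none /= addr0 c0m => /eqP.
    by rewrite mulf_eq0 (_ : (m%:Z == 0) = false) ?orbF => [/eqP //|]; lia.
  move: s0; rewrite c00 scale0r add0r => /indb h i.
  by case: (unliftP ord0 i) => [j ->|-> //]; exact: h.
apply/seteqP; split=> [x Px|x [c ->]]; last first.
  rewrite sumE; have [Pbc _] := Pb (fun i => c (lift ord0 i)).
  rewrite -[X in P (_ + X)]opprK; apply: (PB); last by rewrite -sub0r; apply: (PB).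
  by rewrite -[c ord0]intz scaler_int; exact: (subgroup_mulz P0 PB).
have [c xE] := PA x Px; have := Px; rewrite xE => /divP /dvdzP[q cq].
have : P' (x - x0 *~ q).
  split; first by apply: (PB) => //; exact: (subgroup_mulz P0 PB).
  exists (fun i => c (lift ord0 i) - q * c0 (lift ord0 i)).
  rewrite -scaler_int intz xE scaler_sumr -sumrB big_ord_recl.
  rewrite scalerA -scalerBl cq c0m subrr scale0r add0r.
  by apply: eq_bigr => i _; rewrite scalerA scalerBl.
rewrite defP' => -[cb E].
exists (fun i => oapp cb q (unlift ord0 i)); rewrite sumE.
rewrite unlift_none (eq_bigr (fun i => cb i *: b i)) => [|i _]; last by rewrite liftK.
by rewrite -E -scaler_int intz addrC subrK -xE.
Qed.

(** * Divided power sequences *)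

(** The square of side [N] is a range independent of [n], so that nested sums can be exchanged. *)
Lemma sum_antidiagonal (V : nmodType) N n (F : nat -> nat -> V) : (n < N)%N ->
  \sum_(i < n.+1) F i (n - i)%N =
  \sum_(u : 'I_N * 'I_N | (u.1 + u.2 == n)%N) F u.1 u.2.
Proof.
move=> nN; pose h (i : 'I_n.+1) : 'I_N * 'I_N :=
  (widen_ord nN i, widen_ord nN (rev_ord i)).
have hE i : (h i).2 = (n - i)%N :> nat by rewrite /= subSS.
rewrite (reindex_onto h (fun u => inord u.1)) /=.
  apply: eq_big => [i|i _]; last by rewrite subSS.
  by rewrite subSS inord_val eqxx andbT subnKC ?eqxx // -ltnS.
move=> [u v] /= /eqP uv; have un : (u < n.+1)%N by lia.
by congr pair; apply: val_inj; rewrite /= ?subSS inordK //; lia.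
Qed.

(** Both sides run over the quadruples of total [n]; on the right the condition is visibly symmetric
    in the four indices. *)
Lemma sum_antidiagonal2 (V : nmodType) N n (F : nat -> nat -> nat -> nat -> V) :
  (n < N)%N ->
  \sum_(i < n.+1) \sum_(a < i.+1) \sum_(b < (n - i).+1)
    F a (i - a)%N b (n - i - b)%N =
  \sum_(u : 'I_N * 'I_N) \sum_(v : 'I_N * 'I_N | (u.1 + u.2 + (v.1 + v.2) == n)%N)
    F u.1 u.2 v.1 v.2.
Proof.
move=> nN.
transitivity (\sum_(w : 'I_N * 'I_N | (w.1 + w.2 == n)%N)
  \sum_(u : 'I_N * 'I_N | (u.1 + u.2 == w.1)%N)
    \sum_(v : 'I_N * 'I_N | (v.1 + v.2 == w.2)%N) F u.1 u.2 v.1 v.2).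
  rewrite -(sum_antidiagonal (fun i j =>
   \sum_(u : 'I_N * 'I_N | (u.1 + u.2 == i)%N)
    \sum_(v : 'I_N * 'I_N | (v.1 + v.2 == j)%N) F u.1 u.2 v.1 v.2) nN).
  apply: eq_bigr => i _.
  have iN : (i < N)%N by apply: leq_trans nN; exact: ltn_ord.
  rewrite -(sum_antidiagonal (fun a a' =>
    \sum_(v : 'I_N * 'I_N | (v.1 + v.2 == n - i)%N) F a a' v.1 v.2) iN).
  apply: eq_bigr => a _; rewrite -(sum_antidiagonal (fun b b' => F a (i - a)%N b b')) //.
  by lia.
rewrite (exchange_big_dep xpredT) //=; apply: eq_bigr => u _.
rewrite (exchange_big_dep (fun v : 'I_N * 'I_N => u.1 + u.2 + (v.1 + v.2) == n)%N) /=; last first.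
  by move=> w v /andP[/eqP <- /eqP ->] /eqP ->.
apply: eq_bigr => v /eqP uv.
have lt1 : (u.1 + u.2 < N)%N by lia.
have lt2 : (v.1 + v.2 < N)%N by lia.
rewrite (big_pred1 (Ordinal lt1, Ordinal lt2)) // => -[w1 w2] /=.
apply/andP/eqP => [[/andP[/eqP _ /eqP e1] /eqP e2]|[-> ->]] /=.
  by congr pair; apply: val_inj.
by rewrite uv !eqxx.
Qed.

Section Liftable.
Variables (R : comNzRingType) (H : algType R) (D : coalgebra H).

Lemma pure_suml (T : Type) (r : seq T) (P : pred T) (F : T -> H) (y : H) :
  pure (\sum_(t <- r | P t) F t) y = \sum_(t <- r | P t) pure (F t) y.
Proof.
by apply: (big_morph (fun x => pure x y)) => [x x'|]; rewrite ?pureDl ?pure0l.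
Qed.

Lemma pure_sumr (T : Type) (r : seq T) (P : pred T) (F : T -> H) (x : H) :
  pure x (\sum_(t <- r | P t) F t) = \sum_(t <- r | P t) pure x (F t).
Proof. by apply: big_morph => [y y'|]; rewrite ?pureDr ?pure0r. Qed.

Hypothesis bialg : is_bialgebra D.

Lemma comul1 : comul D 1 = pure 1 1.
Proof. by case: bialg => -[]. Qed.

Lemma comulM x y : comul D (x * y) = comul D x * comul D y.
Proof. by case: bialg => -[_]. Qed.

Lemma liftable0 : liftable D 0.
Proof.
exists (fun n => (n == 0)%:R); split=> // -[|n].
  by rewrite big_ord_recl big_ord0 addr0 comul1.
rewrite linear0 big1 // => -[[|m] mn] _ /=; last by rewrite pure0l.
by rewrite pure0r.
Qed.

Lemma liftableZ k a : liftable D a -> liftable D (k *: a).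
Proof.
(* The weights multiply correctly: [k ^+ m * k ^+ (n - m) = k ^+ n]. *)
move=> [s [s0 s1 sE]]; exists (fun n => k ^+ n *: s n); split=> [||n].
- by rewrite expr0 scale1r.
- by rewrite expr1 s1.
rewrite linearZ /= sE scaler_sumr; apply: eq_bigr => m _.
by rewrite pureZl pureZr scalerA -exprD subnKC // -ltnS.
Qed.

(* The termwise Cauchy product of two divided power sequences is one. *)
Lemma liftableD a b : liftable D a -> liftable D b -> liftable D (a + b).
Proof.
move=> [s [s0 s1 sE]] [t [t0 t1 tE]].
exists (fun n => \sum_(i < n.+1) s i * t (n - i)%N); split=> [||n].
- by rewrite big_ord_recl big_ord0 addr0 s0 t0 mulr1.
- by rewrite big_ord_recl big_ord_recl big_ord0 addr0 s0 t1 mul1r s1 t0 mulr1 addrC.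
rewrite linear_sum.
transitivity (\sum_(i < n.+1) \sum_(a < i.+1) \sum_(b < (n - i).+1)
    pure (s a * t b) (s (i - a)%N * t (n - i - b)%N)).
  apply: eq_bigr => i _; rewrite comulM sE tE mulr_suml; apply: eq_bigr => k _.
  by rewrite mulr_sumr; apply: eq_bigr => l _; rewrite [LHS]tmul_pure.
transitivity (\sum_(i < n.+1) \sum_(a < i.+1) \sum_(b < (n - i).+1)
    pure (s a * t (i - a)%N) (s b * t (n - i - b)%N)); last first.
  apply: eq_bigr => i _; rewrite pure_suml; apply: eq_bigr => k _.
  by rewrite pure_sumr.
rewrite (sum_antidiagonal2 (fun a a' b b' => pure (s a * t b) (s a' * t b')) (ltnSn n)).
rewrite (sum_antidiagonal2 (fun a a' b b' => pure (s a * t a') (s b * t b')) (ltnSn n)).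
rewrite !pair_big_dep /=.
(* The two sides differ by an exchange of the second and third of the four indices. *)
pose h (q : ('I_n.+1 * 'I_n.+1) * ('I_n.+1 * 'I_n.+1)) := ((q.1.1, q.2.1), (q.1.2, q.2.2)).
rewrite (reindex_inj (can_inj (g := h) (f := h) _)) /=; last by move=> [[? ?] [? ?]].
apply: eq_big => [[[a1 a2] [b1 b2]] //=|//].
by rewrite addnACA.
Qed.

End Liftable.

(** * Gradings *)

(** Bundles maps obtained by choice, whose linearity is only established inside a proof. *)
Lemma linear_pack (R : pzRingType) (U V : lmodType R) (f : U -> V) :
  linear f -> exists F : {linear U -> V}, F =1 f.
Proof.
by move=> lf; exists (HB.pack_for {linear U -> V} f (GRing.isLinear.Build R U V _ f lf)).
Qed.

Section Grading.
Variables (R : comNzRingType) (H : lmodType R) (G : nat -> set H).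
Hypothesis gr : is_grading G.

Lemma grading0 d : G d 0.
Proof. by case: gr => /(_ d)[]. Qed.

Lemma gradingZ d (a : R) x : G d x -> G d (a *: x).
Proof.
move=> Gx; case: gr => /(_ d)[G0 /(_ a x 0 Gx G0)]; by rewrite addr0.
Qed.

Lemma gradingD d x y : G d x -> G d y -> G d (x + y).
Proof.
by move=> Gx Gy; case: gr => /(_ d)[_ /(_ 1 x y Gx Gy)]; rewrite scale1r.
Qed.

Lemma gradingB d x y : G d x -> G d y -> G d (x - y).
Proof. by move=> Gx Gy; apply: gradingD; rewrite // -scaleN1r; exact: gradingZ. Qed.

Lemma grading_sum d (T : Type) (r : seq T) (P : pred T) (F : T -> H) :
  (forall t, P t -> G d (F t)) -> G d (\sum_(t <- r | P t) F t).
Proof. by move=> h; elim/big_ind: _; [exact: grading0|exact: gradingD|]. Qed.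

(** The components form a total function with bounded support, so that two decompositions can be
    compared index by index. *)
Definition decomposes (x : H) (h : nat -> H) : Prop :=
  (forall i, G i (h i)) /\
  exists N, (forall i, (N <= i)%N -> h i = 0) /\ x = \sum_(i < N) h i.

Let widen_sum N M (h : nat -> H) : (N <= M)%N ->
  (forall i, (N <= i)%N -> h i = 0) -> \sum_(i < N) h i = \sum_(i < M) h i.
Proof.
move=> NM h0; rewrite (big_ord_widen _ h NM) big_mkcond /=.
by apply: eq_bigr => i _; case: ltnP => // /h0.
Qed.

Lemma decomposes_exists x : exists h, decomposes x h.
Proof.
case: gr => G0 /(_ x)[N [h [Gh ->]]] _.
exists (fun i => if (i < N)%N then h i else 0); split.
  by move=> i; case: ifP => // _; exact: grading0.
exists N; split=> [i|]; first by rewrite ltnNge => ->.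
by apply: eq_bigr => i _; rewrite ltn_ord.
Qed.

Lemma decomposes_uniq x h h' : decomposes x h -> decomposes x h' -> h =1 h'.
Proof.
move=> [Gh [N [hN xE]]] [Gh' [N' [hN' xE']]] i; apply/eqP; rewrite -subr_eq0; apply/eqP.
pose M := maxn i.+1 (maxn N N').
case: gr => _ _ /(_ M (fun i => h i - h' i)); apply.
- by move=> j; exact: gradingB.
- have NM : (N <= M)%N by rewrite /M; lia.
  have NM' : (N' <= M)%N by rewrite /M; lia.
  by rewrite sumrB -(widen_sum NM hN) -(widen_sum NM' hN') -xE -xE' subrr.
- by rewrite /M; lia.
Qed.

Lemma decomposes_hom d x : G d x -> decomposes x (fun i => if i == d then x else 0).
Proof.
move=> Gx; split=> [i|]; first by case: eqP => [->|_] //; exact: grading0.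
exists d.+1; split=> [i|]; first by case: eqP => // ->; rewrite ltnn.
by rewrite big_ord_recr /= eqxx big1 ?add0r // => i _; rewrite ltn_eqF.
Qed.

(** The chosen components depend linearly on the element because decompositions are unique. *)
Lemma grading_proj : exists pi : nat -> {linear H -> H},
  [/\ forall d x, G d (pi d x), forall d x, G d x -> pi d x = x,
      forall d d' x, G d' x -> d' <> d -> pi d x = 0 &
      forall x, exists N, x = \sum_(i < N) pi i x].
Proof.
have [c cP] := choice decomposes_exists.
have lin d : linear (fun x => c x d).
  move=> a x y; apply: (decomposes_uniq (cP _) (h' := fun i => a *: c x i + c y i)).
  have [Gx [N [cN xE]]] := cP x; have [Gy [M [cM yE]]] := cP y.
  split; first by move=> i; apply: gradingD => //; exact: gradingZ.
  exists (maxn N M); split=> [i|].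
    by rewrite geq_max => /andP[/cN -> /cM ->]; rewrite scaler0 addr0.
  rewrite {1}xE {1}yE (widen_sum (leq_maxl N M) cN) (widen_sum (leq_maxr N M) cM).
  by rewrite scaler_sumr -big_split.
have [pi piE] := choice (fun d => linear_pack (lin d)).
have pi_hom d d' x : G d x -> pi d' x = if d' == d then x else 0.
  by move=> Gx; rewrite piE; exact: (decomposes_uniq (cP x) (decomposes_hom Gx)).
exists pi; split=> [d x|d x Gx|d d' x Gx dd'|x].
- by rewrite piE; have [] := cP x.
- by rewrite (pi_hom d) ?eqxx.
- by rewrite (pi_hom d') //; case: eqP => // e; case: dd'.
- have [_ [N [_ xE]]] := cP x; exists N; rewrite {1}xE.
  by apply: eq_bigr => i _; rewrite piE.
Qed.

End Grading.

Section PrimitiveComponents.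
Variables (R : comNzRingType) (H : algType R) (D : coalgebra H) (G : nat -> set H).
Hypothesis graded : is_graded_bialgebra D G.

Let gr : is_grading G. Proof. by case: graded => -[]. Qed.
Let G1 : G 0%N 1. Proof. by case: graded. Qed.

(** The coproduct preserves degrees and hence commutes with the projections to degree [d], as do the
    maps sending [x] to [pure x 1] and to [pure 1 x]. *)
Lemma primitive_components (pi : nat -> {linear H -> H}) :
  (forall d x, G d x -> pi d x = x) ->
  (forall d d' x, G d' x -> d' <> d -> pi d x = 0) ->
  (forall d x, G d (pi d x)) ->
  (forall x, exists N, x = \sum_(i < N) pi i x) ->
  forall a, primitive D a -> forall d, primitive D (pi d a).
Proof.
move=> piK pi0 piG pi_sum a pa d.
(* [q] is the projection of the tensor square onto total degree [d]. *)
pose q (u : H ⊗ H) := \sum_(j < d.+1) tmap (pi j) (pi (d - j)%N) u.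
have bt := @tmap_balanced.
have q0 : q 0 = 0 by rewrite /q big1 // => j _; exact: (tlift0 (bt _ _ _ _ _ _ _)).
have qD : {morph q : u v / u + v}.
  move=> u v; rewrite /q -big_split; apply: eq_bigr => j _.
  exact: (tliftD (bt _ _ _ _ _ _ _)).
have qpure i j x y : G i x -> G j y ->
    q (pure x y) = if (i + j)%N == d then pure x y else 0.
  move=> Gx Gy; rewrite /q.
  have E (k : 'I_d.+1) : tmap (pi k) (pi (d - k)%N) (pure x y) =
      if (i == k) && (j == d - k)%N then pure x y else 0.
    rewrite /tmap (tliftE (bt _ _ _ _ _ _ _)).
    case: (eqVneq i k) => [<-|ik] /=; last by rewrite (pi0 _ _ _ Gx) ?pure0l //; apply/eqP.
    case: (eqVneq j (d - i)%N) => [<-|jd]; first by rewrite !piK.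
    by rewrite (pi0 _ _ _ Gy) ?pure0r //; apply/eqP.
  under eq_bigr => k _ do rewrite E.
  case: eqP => [ijd|ijd].
    have id : (i < d.+1)%N by lia.
    have -> : j = (d - i)%N by lia.
    rewrite (bigD1 (Ordinal id)) //= !eqxx big1 ?addr0 // => k nk.
    case: (i =P k) => //= e; by case/eqP: nk; apply: ord_inj; rewrite /= e.
  rewrite big1 // => k _; case: ifP => // /andP[/eqP e1 /eqP e2].
  by case: ijd; have := ltn_ord k; lia.
have qhom i u : tensor_grading G i u -> q u = if i == d then u else 0.
  move=> [s [sP ->]]; rewrite (big_morph q qD q0).
  elim: s sP => [|[x y] s IH] sP; first by rewrite !big_nil; case: ifP.
  rewrite !big_cons IH; last by move=> z zs; apply: sP; rewrite inE zs orbT.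
  have [j [k [<- /= Gx Gy]]] := sP (x, y) (mem_head _ _).
  by rewrite (qpure _ _ _ _ Gx Gy); case: ifP => // _; rewrite addr0.
have comulG n x : G n x -> tensor_grading G n (comul D x) by case: graded => _ _ _ + _; apply.
have [N aE] := pi_sum a.
have sumq (f : H -> H ⊗ H) : {morph f : x y / x + y} -> f 0 = 0 ->
    (forall i x, G i x -> tensor_grading G i (f x)) -> q (f a) = f (pi d a).
  move=> fD f0 fG; rewrite aE.
  have -> : pi d (\sum_(i < N) pi i a) = \sum_(i < N) (if i == d :> nat then pi i a else 0).
    rewrite linear_sum; apply: eq_bigr => i _.
    by case: eqP => [->|/eqP e]; [exact: piK|apply: (pi0 _ i) => //; apply/eqP].
  rewrite !(big_morph f fD f0) (big_morph q qD q0); apply: eq_bigr => i _.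
  by rewrite (qhom i); [case: ifP|exact: fG].
rewrite /primitive -(sumq (comul D)) ?pa; [|exact: linearD|exact: linear0|exact: comulG].
rewrite qD; congr (_ + _).
- apply: (sumq (fun x => pure x 1)) => [x y||i x Gx]; [exact: pureDl|exact: pure0l|].
  exists [:: (x, 1)]; split; last by rewrite big_seq1.
  by move=> z; rewrite inE => /eqP ->; exists i, 0%N; rewrite addn0.
- apply: (sumq (fun x => pure 1 x)) => [x y||i x Gx]; [exact: pureDr|exact: pure0r|].
  exists [:: (1, x)]; split; last by rewrite big_seq1.
  by move=> z; rewrite inE => /eqP ->; exists 0%N, i; rewrite add0n.
Qed.

End PrimitiveComponents.

(** * Dual monomials *)

Lemma conv_sum (R : comNzRingType) (C : lmodType R) (D : coalgebra C)
    (f g : {linear C -> R^o}) c (T : Type) (r : seq T) (P : pred T) (u v : T -> C) :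
  comul D c = \sum_(t <- r | P t) pure (u t) (v t) ->
  conv D f g c = \sum_(t <- r | P t) f (u t) * g (v t).
Proof.
move=> cE; have b := conv_balanced.
rewrite convE cE (big_morph _ (tliftD (b _ _ f g)) (tlift0 (b _ _ f g))).
by apply: eq_bigr => t _; rewrite tliftE.
Qed.

(** * Multi-indices and weighted degrees *)

Section Monomials.
Variable I : finType.
Implicit Types a b c : {ffun I -> nat}.

Definition madd a b : {ffun I -> nat} := [ffun i => (a i + b i)%N].
Definition msub a b : {ffun I -> nat} := [ffun i => (a i - b i)%N].
Definition mscale m a : {ffun I -> nat} := [ffun i => (m * a i)%N].
Definition mone i : {ffun I -> nat} := [ffun j => (j == i) : nat].
Definition mzero : {ffun I -> nat} := [ffun=> 0%N].

Variable k : I -> nat.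
Definition mdeg a := (\sum_i k i * a i)%N.

Lemma mdegD a b : mdeg (madd a b) = (mdeg a + mdeg b)%N.
Proof. by rewrite /mdeg -big_split; apply: eq_bigr => i _; rewrite ffunE mulnDr. Qed.

Lemma mdegZ m a : mdeg (mscale m a) = (m * mdeg a)%N.
Proof. by rewrite /mdeg big_distrr; apply: eq_bigr => i _; rewrite ffunE mulnCA. Qed.

Lemma mdeg1 i : mdeg (mone i) = k i.
Proof.
rewrite /mdeg (bigD1 i) //= ffunE eqxx muln1 big1 ?addn0 // => j ji.
by rewrite ffunE (negbTE ji) muln0.
Qed.

Lemma mdeg0 : mdeg mzero = 0%N.
Proof. by rewrite /mdeg big1 // => i _; rewrite ffunE muln0. Qed.

Lemma mdeg_ge a i : (k i * a i <= mdeg a)%N.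
Proof. by rewrite /mdeg (bigD1 i) //= leq_addr. Qed.

Lemma madd_msub a b : (forall i, b i <= a i)%N -> madd b (msub a b) = a.
Proof. by move=> ba; apply/ffunP => i; rewrite !ffunE subnKC. Qed.

Lemma madd_one_sub a i : (0 < a i)%N -> madd (mone i) (msub a (mone i)) = a.
Proof. by move=> ai; apply: madd_msub => j; rewrite ffunE; case: eqP => // ->. Qed.

Lemma mzero_or a : a = mzero \/ exists i, (0 < a i)%N.
Proof.
case: (boolP [forall i, a i == 0%N]) => [/forallP h|].
  by left; apply/ffunP => i; rewrite ffunE; apply/eqP.
by move=> /forallPn h; right; have [i hi] := h; exists i; rewrite lt0n.
Qed.

Hypothesis k_gt0 : forall i, (0 < k i)%N.

Lemma le_mdeg a i : (a i <= mdeg a)%N.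
Proof. by apply: leq_trans (mdeg_ge a i); rewrite leq_pmull. Qed.

Lemma mdeg_eq0 a : (mdeg a == 0%N) = (a == mzero).
Proof.
apply/idP/eqP => [/eqP a0|->]; last by rewrite mdeg0.
by apply/ffunP => i; rewrite ffunE; have := le_mdeg a i; rewrite a0 leqn0 => /eqP.
Qed.

Variable n : nat.
Local Notation T := {ffun I -> 'I_n.+1}.

(* Multi-indices with entries at most [n], over which sums are finite. *)
Definition nv (t : T) : {ffun I -> nat} := [ffun i => t i : nat].

Lemma nv_inj : injective nv.
Proof.
by move=> t u /ffunP e; apply/ffunP => i; apply: val_inj; have := e i; rewrite !ffunE.
Qed.

Lemma nv_surj b : (forall i, b i <= n)%N -> exists t, nv t = b.
Proof.
by move=> bn; exists [ffun i => inord (b i)]; apply/ffunP => i; rewrite !ffunE inordK ?ltnS.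
Qed.

Lemma nv_surj_deg b : (mdeg b <= n)%N -> exists t, nv t = b.
Proof. by move=> bn; apply: nv_surj => i; apply: leq_trans (le_mdeg b i) bn. Qed.

End Monomials.

(** * Homogeneous functionals *)

Section Homogeneous.
Variables (H : algType int) (D : coalgebra H) (G : nat -> set H).
Hypothesis graded : is_graded_bialgebra D G.
Implicit Types f g : {linear H -> int^o}.

(** The functionals of degree [d] in the graded dual. *)
Definition homogeneous f d := forall d' z, G d' z -> d' <> d -> f z = 0.

Lemma comul_homogeneous d z : G d z -> exists s : seq (H * H),
  (forall q, q \in s -> exists i j, [/\ (i + j)%N = d, G i q.1 & G j q.2]) /\
  comul D z = \sum_(q <- s) pure q.1 q.2.
Proof. by case: graded => _ _ _ h _; exact: h. Qed.

Lemma counit_homogeneous : homogeneous (counit D) 0.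
Proof. by case: graded => _ _ _ _ h d z Gz /eqP; rewrite -lt0n => d0; apply: h Gz. Qed.

(** Used to replace an element by its component of degree [d] without changing the value of [f]. *)
Lemma homogeneous_pi (pi : nat -> {linear H -> H}) f d z :
  (forall e x, G e (pi e x)) -> (forall x, exists N, x = \sum_(i < N) pi i x) ->
  (forall e e' x, G e' x -> e' <> e -> pi e x = 0) ->
  homogeneous f d -> f (pi d z) = f z.
Proof.
move=> piG pi_sum pi0 hf; have [N zE] := pi_sum z; rewrite [in RHS]zE linear_sum.
have [dN|Nd] := ltnP d N.
  rewrite (bigD1 (Ordinal dN)) //= big1 ?addr0 // => i id.
  by apply: (hf i) => // e; case/eqP: id; exact: val_inj.
rewrite big1 => [|i _]; last first.
  by apply: (hf i) => // e; have := leq_trans (ltn_ord i) Nd; rewrite e ltnn.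
rewrite zE linear_sum big1 ?linear0 // => i _; apply: (pi0 _ i) => // e.
by have := leq_trans (ltn_ord i) Nd; rewrite e ltnn.
Qed.

Lemma conv_homogeneous f g d e :
  homogeneous f d -> homogeneous g e -> homogeneous (conv D f g) (d + e).
Proof.
move=> hf hg d' z /comul_homogeneous [s [sP zE]] dd'.
rewrite (conv_sum _ _ zE) big_seq big1 // => q /sP [i [j [ij Gi Gj]]].
case: (eqVneq i d) => [id|/eqP id]; last by rewrite (hf i) ?mul0r.
by rewrite (hg j) ?mulr0 // => je; apply: dd'; rewrite -ij id je.
Qed.

Lemma conv_exp_homogeneous f d m :
  homogeneous f d -> homogeneous (conv_exp D f m) (d * m).
Proof.
move=> hf; elim: m => [|m IH]; first by rewrite muln0; exact: counit_homogeneous.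
by rewrite mulnS; exact: conv_homogeneous.
Qed.

End Homogeneous.

(** * Monomials in the divided powers and their duals *)

Section Core.
Variables (H : algType int) (D : coalgebra H) (G : nat -> set H).
Hypothesis graded : is_graded_bialgebra D G.
Hypothesis cocomm : cocommutative D.
Hypothesis connected : G 0%N = [set x | exists c : int, x = c *: 1]%classic.

Let bialg : is_bialgebra D. Proof. by case: graded => -[]. Qed.
Let gr : is_grading G. Proof. by case: graded => -[]. Qed.
Let G1 : G 0%N 1. Proof. by case: graded. Qed.
Let GM m n x y : G m x -> G n y -> G (m + n)%N (x * y).
Proof. by case: graded => _ _ h _ _; exact: h. Qed.

(** Cocommutativity makes convolution commutative, so that products of functionals over [I] can be
    rearranged freely. *)
HB.instance Definition _ := Monoid.isComLaw.Build {linear H -> int^o} (counit D)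
  (conv D) (convA D) (convC cocomm) (conv1l D).

Let counit1 : counit D (1%R : H) = 1%R.
Proof. by case: bialg => _ []. Qed.

Variable I : finType.
Variable k : I -> nat.
Hypothesis k_gt0 : forall i, (0 < k i)%N.
Variable X : I -> nat -> H.
Variable n : nat.
(** Each [X i] is a divided power sequence only as far as its terms have degree below [n]; the later
    terms are arbitrary. *)
Hypothesis X0 : forall i, X i 0%N = 1.
Hypothesis XG : forall i m, (k i * m < n)%N -> G (k i * m)%N (X i m).
Hypothesis XD : forall i m, (k i * m < n)%N ->
  comul D (X i m) = \sum_(j < m.+1) pure (X i j) (X i (m - j)%N).

Local Notation M := {ffun I -> nat}.
Local Notation T := {ffun I -> 'I_n.+1}.
Local Notation deg := (mdeg k).
Implicit Types (a b c : M) (xi : I -> {linear H -> int^o}).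

Definition vmon b : H := \prod_i X i (b i).
(** Every factor of [vmon b] lies in the range where [X] is under control, while the degree of the
    whole product may well reach or exceed [n]. *)
Definition valid b : Prop := forall i, (k i * b i < n)%N.
Definition dmon xi a : {linear H -> int^o} :=
  \big[conv D/counit D]_i conv_exp D (xi i) (a i).

Lemma valid_le a b : (forall i, a i <= b i)%N -> valid b -> valid a.
Proof. by move=> ab vb i; apply: leq_ltn_trans (vb i); rewrite leq_mul. Qed.

Lemma valid_deg b : (deg b < n)%N -> valid b.
Proof. by move=> bn i; apply: leq_ltn_trans bn; exact: mdeg_ge. Qed.

Lemma valid_leqn b : valid b -> forall i, (b i <= n)%N.
Proof. by move=> vb i; apply: ltnW; apply: leq_ltn_trans (vb i); rewrite leq_pmull. Qed.

Lemma valid_surj b : valid b -> exists t : T, nv t = b.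
Proof. by move=> vb; apply: nv_surj; exact: valid_leqn. Qed.

Lemma vmon_hom b : valid b -> G (deg b) (vmon b).
Proof.
move=> vb; rewrite /vmon /mdeg.
by elim/big_rec2: _ => // i x d _ Gx; apply: GM => //; exact: XG.
Qed.

Lemma vmon0 : vmon (mzero I) = 1.
Proof. by rewrite /vmon big1 // => i _; rewrite ffunE. Qed.

Lemma vmon_pure i m : vmon (mscale m (mone i)) = X i m.
Proof.
rewrite /vmon (eq_bigr (fun j => if j == i then X j m else 1)).
  by rewrite -big_mkcond big_pred1_eq.
by move=> j _; rewrite !ffunE; case: eqP; rewrite ?muln1 ?muln0.
Qed.

Lemma vmon1 i : vmon (mone i) = X i 1%N.
Proof.
by rewrite -vmon_pure; congr vmon; apply/ffunP => j; rewrite !ffunE mul1n.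
Qed.

(** The coproduct is multiplicative; expanding the product of sums amounts to choosing an index
    [t i <= b i] in each factor. *)
Lemma comul_vmon b : valid b ->
  comul D (vmon b) =
  \sum_(t : T | [forall i, t i <= b i]%N) pure (vmon (nv t)) (vmon (msub b (nv t))).
Proof.
move=> vb; rewrite /vmon.
rewrite (big_morph (comul D) (comulM bialg) (comul1 bialg)).
transitivity (\prod_i \sum_(j : 'I_n.+1 | (j <= b i)%N) pure (X i j) (X i (b i - j)%N)).
  apply: eq_bigr => i _; rewrite XD //.
  have bn : (b i < n.+1)%N by rewrite ltnS; exact: valid_leqn.
  by rewrite (big_ord_widen _ (fun j => pure (X i j) (X i (b i - j)%N)) bn).
rewrite bigA_distr_big_dep /=; apply: eq_big => [t|t _].
  by apply/familyP/forallP.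
under [X in _ = pure _ X]eq_bigr => i _ do rewrite !ffunE.
under [X in _ = pure X _]eq_bigr => i _ do rewrite !ffunE.
by elim/big_rec3: _ => // i x y z _ ->; rewrite [LHS]tmul_pure.
Qed.

Lemma dmonD xi a b : dmon xi (madd a b) = conv D (dmon xi a) (dmon xi b).
Proof.
by rewrite /dmon -big_split; apply: eq_bigr => i _; rewrite ffunE conv_expD.
Qed.

Lemma dmon0 xi : dmon xi (mzero I) = counit D.
Proof. by rewrite /dmon big1 // => i _; rewrite ffunE. Qed.

Lemma dmon1 xi i : dmon xi (mone i) = xi i.
Proof.
rewrite /dmon (eq_bigr (fun j => if j == i then xi j else counit D)).
  by rewrite -big_mkcond big_pred1_eq.
by move=> j _; rewrite ffunE; case: eqP => // _; rewrite conv_expS conv_exp0 convC ?conv1l.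
Qed.

Lemma dmonZ xi a m : dmon xi (mscale m a) = conv_exp D (dmon xi a) m.
Proof.
elim: m => [|m IH].
  by rewrite conv_exp0 -(dmon0 xi); congr dmon; apply/ffunP => i; rewrite !ffunE.
rewrite conv_expS -IH -dmonD; congr dmon.
by apply/ffunP => i; rewrite !ffunE mulSn.
Qed.

Lemma eq_dmon xi xi' a : (forall i, (0 < a i)%N -> xi i = xi' i) -> dmon xi a = dmon xi' a.
Proof.
by move=> e; apply: eq_bigr => i _; case: (posnP (a i)) => [->|/e ->].
Qed.

Lemma dmon_hom xi a : (forall i, homogeneous G (xi i) (k i)) ->
  homogeneous G (dmon xi a) (deg a).
Proof.
move=> hxi; rewrite /dmon /mdeg; elim/big_rec2: _ => [|i d f _ hf].
  exact: counit_homogeneous graded.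
by apply: (conv_homogeneous graded) => //; exact: (conv_exp_homogeneous graded).
Qed.

Lemma conv_vmon f g b : valid b -> conv D f g (vmon b) =
  \sum_(t : T | [forall i, t i <= b i]%N) f (vmon (nv t)) * g (vmon (msub b (nv t))).
Proof. by move=> vb; rewrite (conv_sum _ _ (comul_vmon vb)). Qed.

(** Only the term of the coproduct with left factor [X i 1] survives, so convolution with [f] strips
    one factor from the monomial. [Q] is false when [f] kills all valid monomials. *)
Lemma conv_xi_vmon (Q : bool) i (f g : {linear H -> int^o}) b :
  (forall c, valid c -> f (vmon c) = ((c == mone i) && Q)%:R :> int) -> valid b ->
  conv D f g (vmon b) = if Q && (0 < b i)%N then g (vmon (msub b (mone i))) else 0.
Proof.
move=> fE vb; rewrite conv_vmon //.
have vle (t : T) : [forall i, t i <= b i]%N -> valid (nv t).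
  by move=> /forallP tb; apply: valid_le vb => j; rewrite ffunE.
rewrite (eq_bigr (fun t =>
    if (nv t == mone i) && Q then g (vmon (msub b (nv t))) else 0)); last first.
  by move=> t /vle vt; rewrite fE //; case: ifP; rewrite ?mul1r ?mul0r.
case: Q {fE} => /=; last by rewrite big1 // => t _; rewrite andbF.
under eq_bigr => t _ do rewrite andbT.
rewrite -big_mkcondr /=; case: ltnP => bi; last first.
  rewrite big_pred0 // => t; apply/negbTE/negP => /andP[/forallP /(_ i) tb /eqP ti].
  have := congr1 (fun a : M => a i) ti; rewrite !ffunE eqxx => e.
  by move: tb; rewrite e leqNgt ltnS bi.
have [|t tE] := @valid_surj (mone i).
  by apply: valid_le vb => j; rewrite ffunE; case: eqP => // ->.
rewrite (big_pred1 t) ?tE // => u /=; rewrite -tE (inj_eq (@nv_inj _ _)).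
case: eqP => [->|_]; last by rewrite andbF.
rewrite andbT; apply/forallP => j; have := congr1 (fun a : M => a j) tE.
by rewrite !ffunE => ->; case: eqP => // ->.
Qed.

(* [Q] selects the generators treated so far; for the others, [xi i] vanishes on
   all the monomials. *)
Definition dual (Q : pred I) xi : Prop :=
  (forall i, homogeneous G (xi i) (k i)) /\
  forall i b, valid b -> xi i (vmon b) = ((b == mone i) && Q i)%:R :> int.

(** Induction on the degree of [a]: splitting off one [xi i] lowers the exponent of [b] at [i] by
    one, by [conv_xi_vmon]. *)
Lemma pairing Q xi a b : dual Q xi -> valid b ->
  dmon xi a (vmon b) = ((a == b) && [forall i, (0 < a i)%N ==> Q i])%:R :> int.
Proof.
move=> [xiG xiE].
have [m] := ubnP (deg a); elim: m a b => // m IH a b am vb.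
case: (mzero_or a) => [->|[i ai]].
  rewrite dmon0; have -> : [forall i, (0 < mzero I i)%N ==> Q i].
    by apply/forallP => i; rewrite ffunE.
  rewrite andbT; case: eqP => [<-|b0]; first by rewrite vmon0.
  apply: (counit_homogeneous graded (vmon_hom vb)) => /eqP.
  by rewrite mdeg_eq0 // => /eqP e; apply: b0.
have aE := madd_one_sub ai; set a' := msub a (mone i) in aE.
rewrite -aE dmonD dmon1 (conv_xi_vmon (Q := Q i) (i := i)) //; last exact: xiE.
have am' : (deg a' < m)%N.
  by move: am; rewrite -aE mdegD mdeg1; have := k_gt0 i; lia.
have [bi|bi] := ltnP 0 (b i); last first.
  rewrite andbF (_ : (_ == b) = false) //; apply/eqP => e.
  by move: bi; rewrite -e !ffunE eqxx.
have bE := madd_one_sub bi; set b' := msub b (mone i) in bE *.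
rewrite IH //; last by apply: valid_le vb => j; rewrite !ffunE leq_subr.
have -> : (madd (mone i) a' == b) = (a' == b').
  rewrite -bE; apply/eqP/eqP => [/ffunP e|-> //].
  by apply/ffunP => j; have := e j; rewrite !ffunE; lia.
rewrite andbT; have -> : [forall j, (0 < madd (mone i) a' j)%N ==> Q j] =
    Q i && [forall j, (0 < a' j)%N ==> Q j].
  apply/forallP/andP => [h|[Qi /forallP h] j].
    split; first by have := h i; rewrite ffunE [mone i i]ffunE eqxx.
    apply/forallP => j; apply/implyP => aj; move/implyP: (h j); apply.
    by rewrite ffunE addn_gt0 aj orbT.
  apply/implyP; rewrite ffunE addn_gt0 ffunE lt0b => /orP[/eqP -> //|].
  exact/implyP.
by case: (Q i) => //=; rewrite andbF.
Qed.

(** The dual basis expansion in degree [d]. *)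
Definition spanned xi d : Prop := forall z, G d z ->
  z = \sum_(t : T | deg (nv t) == d) dmon xi (nv t) z *: vmon (nv t).

(** Terms of the coproduct with a factor of degree 0 give the first two summands, by connectedness
    and the counit laws. In the other terms both factors have degree strictly between 0 and [d] and
    expand by [spanned]; the products of their coordinates add up to a value of [dmon] by
    [dmonD]. *)
Lemma comul_expand xi d z : (forall i, homogeneous G (xi i) (k i)) ->
  (forall d', (0 < d' < d)%N -> spanned xi d') -> (0 < d)%N -> G d z ->
  comul D z = pure z 1 + pure 1 z +
    \sum_(s : T | (0 < deg (nv s))%N)
      \sum_(t : T | (0 < deg (nv t))%N && (deg (nv s) + deg (nv t) == d)%N)
        dmon xi (madd (nv s) (nv t)) z *: pure (vmon (nv s)) (vmon (nv t)).
Proof.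
move=> hxi sp d0 Gz; have [r [rP zE]] := comul_homogeneous graded Gz.
have hd a := dmon_hom (a := a) hxi.
have br := counit_balancedr (counit D).
have bl := counit_balancedl (counit D).
have zr : z = \sum_(q <- r) counit D q.2 *: q.1.
  rewrite -[LHS](counitr D) zE (big_morph _ (tliftD br) (tlift0 br)).
  by apply: eq_bigr => q _; rewrite tliftE.
have zl : z = \sum_(q <- r) counit D q.1 *: q.2.
  rewrite -[LHS](counitl D) zE (big_morph _ (tliftD bl) (tlift0 bl)).
  by apply: eq_bigr => q _; rewrite tliftE.
pose rest (q : H * H) := \sum_(s : T | (0 < deg (nv s))%N)
      \sum_(t : T | (0 < deg (nv t))%N && (deg (nv s) + deg (nv t) == d)%N)
   (dmon xi (nv s) q.1 * dmon xi (nv t) q.2) *: pure (vmon (nv s)) (vmon (nv t)).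
transitivity (\sum_(q <- r) (pure (counit D q.2 *: q.1) 1 +
    pure 1 (counit D q.1 *: q.2) + rest q)); last first.
  rewrite !big_split /= -pure_suml -pure_sumr -zr -zl; congr (_ + _).
  rewrite exchange_big /=; apply: eq_bigr => s _.
  rewrite exchange_big /=; apply: eq_bigr => t _.
  by rewrite dmonD (conv_sum _ _ zE) scaler_suml.
rewrite zE big_seq [RHS]big_seq; apply: eq_bigr => -[x y] /rP /= [i [j [ijd Gx Gy]]].
have counit0 e u : (0 < e)%N -> G e u -> counit D u = 0.
  by move=> e0 Ge; apply: (counit_homogeneous graded Ge) => e1; rewrite e1 in e0.
have rest0 u v : (forall s : T, (0 < deg (nv s))%N -> dmon xi (nv s) u = 0) \/
    (forall t : T, (0 < deg (nv t))%N -> dmon xi (nv t) v = 0) -> rest (u, v) = 0.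
  move=> h; rewrite /rest big1 // => s s0; rewrite big1 // => t /andP[t0 _] /=.
  by case: h => [/(_ s s0)|/(_ t t0)] ->; rewrite ?mul0r ?mulr0 scale0r.
have dmon0 e u (s : T) : G e u -> e <> deg (nv s) -> dmon xi (nv s) u = 0.
  by move=> Gu; exact: (hd _ _ _ Gu).
have conn u : G 0%N u -> u = counit D u *: 1.
  by rewrite {1}connected => -[c ->]; rewrite functionalZ counit1 mulr1.
case: (posnP i) => [i0|i0].
  have jd : (0 < j)%N by rewrite -ijd i0 in d0.
  rewrite (counit0 _ _ jd Gy) scale0r pure0l add0r rest0 ?addr0; last first.
    by left=> s s0; apply: (dmon0 _ _ _ Gx); rewrite i0 => e; rewrite -e in s0.
  by rewrite {1}[x]conn -?pure_balanced // -i0.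
case: (posnP j) => [j0|j0].
  rewrite (counit0 _ _ i0 Gx) scale0r pure0r addr0 rest0 ?addr0; last first.
    by right=> s s0; apply: (dmon0 _ _ _ Gy); rewrite j0 => e; rewrite -e in s0.
  by rewrite {1}[y]conn ?pure_balanced // -j0.
rewrite (counit0 _ _ i0 Gx) (counit0 _ _ j0 Gy) !scale0r pure0l pure0r !add0r.
have id : (0 < i < d)%N by lia.
have jd : (0 < j < d)%N by lia.
rewrite {1}(sp i id x Gx) {1}(sp j jd y Gy) pure_suml /rest /= big_mkcond [RHS]big_mkcond.
apply: eq_bigr => s _; case: eqP => si; last first.
  case: ifP => // s0; rewrite big1 // => t _; rewrite (dmon0 _ _ _ Gx) ?mul0r ?scale0r //.
  by move=> e; apply: si.
rewrite si i0 pure_sumr; apply: eq_big => [t|t _].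
  by rewrite -ijd eqn_add2l; case: eqP => [->|]; rewrite ?j0 ?andbF.
by rewrite pureZl pureZr scalerA.
Qed.

(** By [comul_expand] the reduced coproduct involves [dmon xi c] only for sums [c] of two nonzero
    multi-indices, and no [mone i] is such a sum. *)
Lemma primitive_test xi d z : (forall i, homogeneous G (xi i) (k i)) ->
  (forall d', (0 < d' < d)%N -> spanned xi d') -> (0 < d)%N -> G d z ->
  (forall c, deg c = d -> (forall i, c <> mone i) -> dmon xi c z = 0) ->
  primitive D z.
Proof.
move=> hxi sp d0 Gz z0; rewrite /primitive (comul_expand hxi sp d0 Gz).
rewrite [X in _ + X]big1 ?addr0 // => s s0; rewrite big1 // => t /andP[t0 /eqP std].
rewrite z0 ?scale0r ?mdegD // => i /ffunP e.
move: s0 t0; rewrite !lt0n !mdeg_eq0 // => /eqP s0 /eqP t0.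
(* A nonzero multi-index below [mone i] is positive at [i], so two of them would add up to at least
   2 there. *)
have supp (u : M) : (forall l, (u l <= mone i l)%N) -> u <> mzero I -> (0 < u i)%N.
  move=> le /= u0; rewrite lt0n; apply/eqP => ui; apply: u0; apply/ffunP => l.
  have := le l; rewrite !ffunE; case: (l =P i) => [->|_]; first by rewrite ui.
  by rewrite leqn0 => /eqP.
have := e i; have := supp (nv s) _ s0; have := supp (nv t) _ t0.
rewrite !ffunE eqxx /= => h1 h2 h3.
have : (0 < t i)%N by apply: h1 => l; rewrite -e !ffunE leq_addl.
have : (0 < s i)%N by apply: h2 => l; rewrite -e !ffunE leq_addr.
by move=> si ti; have := leq_add si ti; rewrite h3.
Qed.

(** * Construction of the dual functionals *)

Hypothesis X_basis : forall d, (0 < d < n)%N -> forall z, G d z -> primitive D z ->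
  exists c : I -> int, z = \sum_(i | k i == d) c i *: X i 1%N.
Hypothesis X_free : forall d (c : I -> int),
  \sum_(i | k i == d) c i *: X i 1%N = 0 -> forall i, k i == d -> c i = 0.
Hypothesis k_lt : forall i, (k i < n)%N.

Let X_coord_uniq d (c c' : I -> int) :
  \sum_(i | k i == d) c i *: X i 1%N = \sum_(i | k i == d) c' i *: X i 1%N ->
  forall i, k i == d -> c i = c' i.
Proof.
move=> e i kd; apply/eqP; rewrite -subr_eq0; apply/eqP.
apply: (X_free (d := d) (c := fun i => c i - c' i)) => //.
by under eq_bigr => j _ do rewrite scalerBl; rewrite sumrB e subrr.
Qed.

Definition low m (a : M) := [forall i, (0 < a i)%N ==> (k i < m)%N].

(** A generator of degree at least [m] in a monomial of degree [m] uses up the whole degree. *)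
Lemma low_or m a : deg a = m -> low m a \/ exists i, a = mone i.
Proof.
move=> am; case: (boolP (low m a)) => [|/forallPn[i]]; first by left.
rewrite negb_imply -leqNgt => /andP[ai ki]; right; exists i.
have aE := madd_one_sub ai; have := mdegD k (mone i) (msub a (mone i)).
rewrite aE am mdeg1 => e.
have /eqP : deg (msub a (mone i)) = 0%N by lia.
rewrite mdeg_eq0 // => /eqP e0; rewrite -aE e0.
by apply/ffunP => j; rewrite !ffunE addn0.
Qed.

Lemma low_mone m i : low m (mone i) = (k i < m)%N.
Proof.
apply/forallP/idP => [/(_ i)|ki j]; first by rewrite ffunE eqxx.
by rewrite ffunE; case: eqP => // ->; rewrite ki.
Qed.

Lemma sum_not_low (V : nmodType) m (F : M -> V) :
  \sum_(t : T | (deg (nv t) == m) && ~~ low m (nv t)) F (nv t) =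
  \sum_(i | k i == m) F (mone i).
Proof.
have ex i : exists t : T, nv t = mone i.
  by apply: nv_surj_deg => //; rewrite mdeg1 ltnW.
have [h hE] := choice ex.
have h_inj : injective h.
  move=> i j e; have := hE i; rewrite e hE => /ffunP /(_ j).
  by rewrite !ffunE eqxx; case: eqP.
transitivity (\sum_(t in [set h i | i : I & k i == m]%SET) F (nv t)).
  apply: eq_bigl => t; apply/andP/imsetP => [[/eqP tm nl]|[i]].
    case: (low_or tm) => [l|[i e]]; first by rewrite l in nl.
    exists i; first by rewrite inE -tm e mdeg1.
    by apply: nv_inj; rewrite hE.
  by rewrite inE => /eqP ki ->; rewrite hE mdeg1 ki eqxx low_mone ki ltnn.
rewrite big_imset /=; last by move=> i j _ _; exact: h_inj.
by apply: eq_big => [i|i _]; rewrite ?inE ?hE.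
Qed.

(** Induction on [m]: an element of degree [m] minus its part along monomials in lower generators is
    primitive, and its coordinates in the basis of primitives define the functionals for the
    generators of degree [m]. *)
Lemma dual_exists m : (m < n)%N -> exists xi,
  dual (fun i => k i < m.+1)%N xi /\ forall d, (d < m.+1)%N -> spanned xi d.
Proof.
elim: m => [|m IH] mn.
  (* No generator has degree 0, so at the start all functionals can be zero. *)
  have lin0 : linear ((fun=> 0) : H -> int^o) by move=> u x y; rewrite scaler0 addr0.
  have [f fE] := linear_pack lin0.
  exists (fun=> f); split.
    split=> [i d z _ _|i b _]; first exact: fE.
    by rewrite ltnNge k_gt0 andbF fE.
  move=> d; rewrite ltnS leqn0 => /eqP -> z.
  rewrite {1}connected => -[c ->].
  have [|t tE] := @nv_surj_deg _ _ k_gt0 n (mzero I); first by rewrite mdeg0.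
  rewrite (big_pred1 t) => [|u]; last by rewrite mdeg_eq0 // -tE (inj_eq (@nv_inj _ _)).
  by rewrite tE dmon0 vmon0 functionalZ counit1 mulr1.
have [|xi [[xiG xiE] xiS]] := IH; first exact: ltnW.
have {IH} dl : dual (fun i => k i < m.+1)%N xi by [].
set d := m.+1 in mn dl xiE xiS *.
have [pi [piG piK pi0 pi_sum]] := grading_proj gr.
have hd a := dmon_hom (a := a) xiG.
have hd_pi a z : deg a = d -> dmon xi a (pi d z) = dmon xi a z.
  by move=> <-; exact: homogeneous_pi piG pi_sum pi0 (hd a).
(* The part of [z] along the monomials in generators of degree below [d], to which [xi] is already
   dual. *)
pose F z := \sum_(t : T | (deg (nv t) == d) && low d (nv t)) dmon xi (nv t) z *: vmon (nv t).
pose z' z := pi d z - F z.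
have valid_d b : deg b = d -> valid b by move=> bd; apply: valid_deg; rewrite bd.
have FG z : G d (F z).
  apply: grading_sum => // t /andP[/eqP td _]; apply: gradingZ => //.
  by rewrite -td; apply: vmon_hom; exact: valid_d.
have F_lin : linear F.
  move=> u x y; rewrite /F scaler_sumr -big_split; apply: eq_bigr => t _.
  by rewrite linearP scalerDl scalerA.
have F_vmon b : deg b = d -> F (vmon b) = if low d b then vmon b else 0.
  move=> bd; have [|t tE] := @nv_surj_deg _ _ k_gt0 n b; first by rewrite bd ltnW.
  rewrite /F (eq_bigr (fun u => if u == t then if low d b then vmon b else 0 else 0)).
    rewrite -big_mkcondr /=; case: ifP => lb; last by rewrite big1.
    by rewrite (big_pred1 t) // => u /=; case: (u =P t) => [->|]; rewrite ?andbF // tE bd eqxx lb.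
  move=> u /andP[ud lu]; rewrite (pairing (nv u) dl (valid_d _ bd)) -tE (inj_eq (@nv_inj _ _)).
  case: (u =P t) => [-> |]; last by rewrite scale0r.
  by rewrite andTb -/(low d (nv t)); case: ifP => _; rewrite ?scale1r ?scale0r.
have dmonF c z : deg c = d -> low d c -> dmon xi c (F z) = dmon xi c z.
  move=> cd lc; have [|t tE] := @nv_surj_deg _ _ k_gt0 n c; first by rewrite cd ltnW.
  rewrite /F linear_sum (bigD1 t) /=; last by rewrite tE cd eqxx.
  rewrite functionalZ (pairing c dl) tE; last exact: valid_d.
  rewrite eqxx andTb -/(low d c) lc mulr1 big1 ?addr0 // => u /andP[/andP[/eqP ud _] ut].
  rewrite functionalZ (pairing c dl) -?tE; last exact: valid_d.
  by rewrite (inj_eq (@nv_inj _ _)) eq_sym (negbTE ut) mulr0.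
(* Low dual monomials agree on [pi d z] and [F z], and [primitive_test] leaves out the single
   generators. *)
have z'_prim z : primitive D (z' z).
  apply: (primitive_test xiG (d := d)) => //.
  - by move=> d' /andP[_]; exact: xiS.
  - by apply: gradingB => //; exact: piG.
  move=> c cd nc; have lc : low d c by case: (low_or cd) => // -[i /nc].
  by rewrite linearB hd_pi // dmonF // subrr.
have ex z : exists c : I -> int, z' z = \sum_(i | k i == d) c i *: X i 1%N.
  apply: (X_basis (d := d)) => //; exact: gradingB (piG d z) (FG z).
have [cf cfE] := choice ex.
have cf_uniq z (c : I -> int) : z' z = \sum_(i | k i == d) c i *: X i 1%N ->
    forall i, k i == d -> cf z i = c i.
  by rewrite cfE; exact: X_coord_uniq.
(* In degree [d] the new functionals are the coordinates of [z' z]; all others are kept. *)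
have ex_xi i : exists f : {linear H -> int^o},
    if k i == d then f =1 (fun z => cf z i) else f = xi i.
  case: eqP => [/eqP ki|_]; last by exists (xi i).
  have lin : linear ((fun z => cf z i) : H -> int^o).
    move=> u x y; apply: (cf_uniq _ (fun j => u * cf x j + cf y j)) => //.
    rewrite /z' F_lin linearP opprD addrACA -scalerBr -/(z' x) -/(z' y) !cfE.
    rewrite scaler_sumr -big_split.
    by apply: eq_bigr => j _; rewrite scalerDl scalerA.
  by have [f fE] := linear_pack lin; exists f.
have [xi' xi'E] := choice ex_xi.
have xi'_eq i : k i == d -> xi' i =1 (fun z => cf z i).
  by move=> ki; have := xi'E i; rewrite ki.
have xi'_neq i : k i != d -> xi' i = xi i.
  by move=> ki; have := xi'E i; rewrite (negbTE ki).
have xi'G i : homogeneous G (xi' i) (k i).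
  case: (boolP (k i == d)) => [ki|/xi'_neq -> //] e z Gz ek.
  rewrite xi'_eq //; apply: (cf_uniq z (fun=> 0)) => //.
  rewrite [RHS]big1 => [|j _]; last by rewrite scale0r.
  rewrite (eqP ki) in ek; rewrite /z' /F (pi0 d e z Gz) // big1 ?subrr // => t /andP[/eqP td _].
  by rewrite (hd _ e z Gz) ?scale0r // td.
exists xi'; split.
  split=> // i b vb; case: (boolP (k i == d)) => [ki|ki]; last first.
    by rewrite xi'_neq // xiE // ltnS [in RHS]leq_eqVlt (negbTE ki).
  rewrite (eqP ki) ltnSn andbT.
  have [bd|/eqP bd] := eqVneq (deg b) d; last first.
    rewrite (xi'G i _ _ (vmon_hom vb)) ?(eqP ki) //.
    by case: eqP => // be; case: bd; rewrite be mdeg1 (eqP ki).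
  rewrite xi'_eq //.
  have z'E : z' (vmon b) = if low d b then 0 else vmon b.
    rewrite /z' F_vmon // piK; last by rewrite -bd; exact: vmon_hom.
    by case: ifP; rewrite ?subrr ?subr0.
  case: (low_or bd) => [lb|[j bj]].
    rewrite lb in z'E; rewrite (cf_uniq _ (fun=> 0)) //; last first.
      by rewrite z'E big1 // => j _; rewrite scale0r.
    by case: eqP lb => // ->; rewrite low_mone (eqP ki) ltnn.
  have kj : k j = d by rewrite -bd bj mdeg1.
  rewrite bj low_mone kj ltnn vmon1 in z'E; rewrite bj vmon1.
  rewrite (cf_uniq _ (fun i => (i == j)%:R)) //; last first.
    rewrite z'E (bigD1 j) /= ?kj // eqxx scale1r big1 ?addr0 // => l /andP[_ /negbTE ->].
    by rewrite scale0r.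
  congr ((nat_of_bool _)%:R); apply/eqP/eqP => [-> //|/ffunP /(_ i)]; rewrite !ffunE eqxx.
  by case: eqP => // ->.
move=> e; rewrite ltnS leq_eqVlt => /predU1P[->|ed] z Gz; last first.
  rewrite [LHS](xiS e ed z Gz); apply: eq_bigr => t /eqP te.
  congr (_ *: _); rewrite (_ : dmon xi' _ = dmon xi (nv t)) //; apply: eq_dmon => i ti.
  apply: xi'_neq; rewrite neq_ltn (leq_trans _ ed) // ltnS -te.
  by apply: leq_trans (mdeg_ge k (nv t) i); rewrite leq_pmulr.
(* In degree [d] the low multi-indices contribute [F z] and the single generators contribute
   [z' z]. *)
rewrite (bigID (fun t => low d (nv t))) /=.
rewrite (sum_not_low d (fun a => dmon xi' a z *: vmon a)).
rewrite (eq_bigr (fun t => dmon xi (nv t) z *: vmon (nv t))) -/(F z); last first.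
  move=> t /andP[_ /forallP lt]; congr (_ *: _).
  rewrite (_ : dmon xi' _ = dmon xi (nv t)) //; apply: eq_dmon => i ti.
  by apply: xi'_neq; have := lt i; rewrite ti /= neq_ltn => ->.
rewrite (eq_bigr (fun i => cf z i *: X i 1%N)); last first.
  by move=> i ki; rewrite dmon1 vmon1 xi'_eq.
by rewrite -cfE /z' piK // addrC subrK.
Qed.

(** * Pure powers in degree [n] *)

Lemma mscale_one_eq m m' (i j : I) : (0 < m)%N ->
  (mscale m (mone i) == mscale m' (mone j)) = (i == j) && (m == m').
Proof.
move=> m0; apply/eqP/andP => [/ffunP /(_ i)|[/eqP -> /eqP -> //]].
rewrite !ffunE eqxx muln1; case: (i == j) => /=; first by rewrite muln1 => ->; rewrite eqxx.
by rewrite muln0 => e; rewrite e in m0.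
Qed.

Lemma mdeg_pure m i : deg (mscale m (mone i)) = (k i * m)%N.
Proof. by rewrite mdegZ mdeg1 mulnC. Qed.

Lemma valid_pure m i : (k i * m < n)%N -> valid (mscale m (mone i)).
Proof. by move=> kn; apply: valid_deg; rewrite mdeg_pure. Qed.

(** A factor violating validity uses up the whole degree [n], and [k_lt] forces its exponent above
    1. These pure powers are the only monomials of degree [n] not yet given by products. *)
Lemma not_valid_pure b : deg b = n -> ~ valid b ->
  exists i m, [/\ b = mscale m (mone i), (k i * m)%N = n & (1 < m)%N].
Proof.
move=> bn /existsNP[i /negP]; rewrite -leqNgt => ni.
exists i, (b i); have e : (k i * b i)%N = n.
  by apply/eqP; rewrite eqn_leq ni -bn mdeg_ge.
split=> //; last first.
  have := k_lt i; rewrite -e; case: (b i) => [|[|//]]; first by rewrite muln0.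
  by rewrite muln1 ltnn.
apply/ffunP => j; rewrite !ffunE; case: eqP => [->|ji]; first by rewrite muln1.
rewrite muln0; move: bn; rewrite /mdeg (bigD1 i) //= (bigD1 j) /=; last exact/eqP.
rewrite e => /eqP; rewrite -[X in _ == X]addn0 eqn_add2l addn_eq0 muln_eq0.
by case/andP => /orP[/eqP k0|/eqP //] _; have := k_gt0 j; rewrite k0.
Qed.

(** The Leibniz rule for multiplication by the primitive element [X i 1]. *)
Lemma conv_mul_primitive (f g : {linear H -> int^o}) i q : (k i * q < n)%N ->
  conv D f g (X i q * X i 1%N) = \sum_(j < q.+1)
    (f (X i j * X i 1%N) * g (X i (q - j)%N) + f (X i j) * g (X i (q - j)%N * X i 1%N)) :> int.
Proof.
move=> kq; have cE : comul D (X i q * X i 1%N) =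
    (* The sum type merges both Leibniz terms into the single sum that [conv_sum] expects. *)
    \sum_(u : 'I_q.+1 + 'I_q.+1) match u with
      | inl j => pure (X i j * X i 1%N) (X i (q - j)%N)
      | inr j => pure (X i j) (X i (q - j)%N * X i 1%N) end.
  have pX : comul D (X i 1%N) = pure 1 (X i 1%N) + pure (X i 1%N) 1.
    by rewrite XD ?muln1 // !big_ord_recl big_ord0 /= !X0 addr0.
  rewrite (comulM bialg) pX (XD kq) mulr_suml big_sumType /= -big_split /=.
  apply: eq_bigr => j _; rewrite mulrDr [_ * pure 1 _]tmul_pure [_ * pure _ 1]tmul_pure.
  by rewrite !mulr1 addrC.
pose u (t : 'I_q.+1 + 'I_q.+1) := match t with inl j => X i j * X i 1%N | inr j => X i j end.
pose v (t : 'I_q.+1 + 'I_q.+1) :=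
  match t with inl j => X i (q - j)%N | inr j => X i (q - j)%N * X i 1%N end.
rewrite (@conv_sum _ _ _ f g _ _ (index_enum _) xpredT u v).
  by rewrite big_sumType big_split.
by rewrite cE; apply: eq_bigr => -[].
Qed.

Variable xi : I -> {linear H -> int^o}.
Hypothesis xi_hom : forall i, homogeneous G (xi i) (k i).
Hypothesis xi_pair : forall a b, valid b -> dmon xi a (vmon b) = (a == b)%:R :> int.
Hypothesis xi_span : forall d, (d < n)%N -> spanned xi d.

Lemma pairing_pure l m i q : (k i * q < n)%N -> (0 < m)%N ->
  conv_exp D (xi l) m (X i q) = ((l == i) && (m == q))%:R :> int.
Proof.
move=> kq m0; rewrite -vmon_pure -(dmon1 xi) -dmonZ xi_pair; last exact: valid_pure.
by rewrite mscale_one_eq.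
Qed.

(** In each Leibniz term one factor evaluates a power of [xi l] at some [X i e], which is zero for
    distinct [l] and [i]. *)
Lemma conv_exp_mul_primitive_neq l m i q : (k i * q < n)%N -> l != i -> (1 < m)%N ->
  conv_exp D (xi l) m (X i q * X i 1%N) = 0 :> int.
Proof.
case: m => [|[|m]] // kq li _; rewrite conv_expS conv_mul_primitive // big1 // => j _.
have le e : (e <= q)%N -> (k i * e < n)%N.
  by move=> eq; apply: leq_ltn_trans kq; rewrite leq_mul.
rewrite pairing_pure ?le ?leq_subr // (negbTE li) mulr0 add0r.
have -> : xi l (X i j) = conv_exp D (xi l) 1 (X i j) :> int.
  by rewrite conv_expS conv_exp0 convC ?conv1l.
by rewrite pairing_pure ?le ?(negbTE li) ?mul0r // -ltnS.
Qed.

(* [f |-> f (_ * x)] is a derivation of the dual algebra for primitive [x], so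
   this is the derivative of [xi ^ q.+1] evaluated against [X q]. *)
Lemma conv_exp_mul_primitive i q : (k i * q < n)%N ->
  conv_exp D (xi i) q.+1 (X i q * X i 1%N) = q.+1%:R :> int.
Proof.
have xi1 : xi i 1 = 0.
  by apply: (xi_hom G1) => e; have := k_gt0 i; rewrite -e.
have xiX : xi i (X i 1%N) = 1 :> int.
  by rewrite -vmon1 -(dmon1 xi) xi_pair ?eqxx //; apply: valid_deg; rewrite mdeg1.
elim: q => [|q IH] kq; rewrite conv_expS conv_mul_primitive //.
  by rewrite big_ord_recl big_ord0 addr0 /= X0 mul1r counit1 mulr1 xi1 mul0r addr0.
have le e : (e <= q.+1)%N -> (k i * e < n)%N.
  by move=> eq; apply: leq_ltn_trans kq; rewrite leq_mul.
have xi_X e : (e <= q.+1)%N -> xi i (X i e) = (e == 1%N)%:R :> int.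
  move=> eq; have -> : xi i (X i e) = conv_exp D (xi i) 1 (X i e) :> int.
    by rewrite conv_expS conv_exp0 convC ?conv1l.
  by rewrite pairing_pure ?le // eqxx eq_sym.
have gX e : (e <= q.+1)%N -> conv_exp D (xi i) q.+1 (X i e) = (q.+1 == e)%:R :> int.
  by move=> eq; rewrite pairing_pure ?le // eqxx.
have {IH} gM := IH (le q (leqnSn q)).
move: (conv_exp D (xi i) q.+1) gX gM => g gX gM.
(* In the first sum only [j = 0] survives, with value 1; in the second only [j = 1], with value
   [q.+1] by [gM]. *)
rewrite big_split /= big_ord_recl [X in _ + X]big_ord_recl /= !X0 mul1r subn0.
rewrite gX // eqxx xiX xi1 mul0r.
rewrite big1 => [|j _]; last first.
  rewrite gX ?leq_subr // [_ == _](_ : _ = false) ?mulr0 //.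
  by apply/eqP; rewrite /bump /=; have := ltn_ord j; lia.
rewrite big_ord_recl /= xi_X // eqxx subSS subn0 gM.
rewrite big1 => [|j _]; last by rewrite xi_X ?mul0r // /bump /=; have := ltn_ord j; lia.
by rewrite mulr1 mul1r !addr0 add0r -[in RHS]natr1 addrC.
Qed.

(** * The lattice of realizable values *)

Hypothesis n_gt0 : (0 < n)%N.

(* The values of [v] at monomials of degree other than [n] are irrelevant. *)
Definition realizable (v : {ffun T -> int}) : Prop :=
  exists2 z, G n z & forall t, deg (nv t) = n -> dmon xi (nv t) z = v t :> int.

Let delta (t : T) : {ffun T -> int} := [ffun u => (u == t)%:R].

Let ffun_mulz (f : {ffun T -> int}) (m : int) u : (f *~ m) u = f u * m.
Proof.
have N j : (f *+ j) u = f u * j%:Z.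
  elim: j => [|j IH]; first by rewrite mulr0n ffunE mulr0.
  by rewrite mulrS ffunE IH intS mulrDr mulr1.
by case: m => j; [exact: N|rewrite NegzE mulrNz ffunE -pmulrn N mulrN].
Qed.

Lemma ffun_delta (v : {ffun T -> int}) : v = \sum_t delta t *~ v t.
Proof.
apply/ffunP => u; rewrite sum_ffunE (bigD1 u) //= big1 ?addr0 => [|t tu].
  by rewrite ffun_mulz ffunE eqxx mul1r.
by rewrite ffun_mulz ffunE eq_sym (negbTE tu) mul0r.
Qed.

Lemma realizable0 : realizable 0.
Proof. by exists 0 => [|t _]; rewrite ?linear0 ?ffunE //; exact: grading0. Qed.

Lemma realizableB v w : realizable v -> realizable w -> realizable (v - w).
Proof.
move=> [x Gx xE] [y Gy yE]; exists (x - y) => [|t tn]; first exact: gradingB.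
by rewrite linearB !ffunE /= xE // yE.
Qed.

Lemma realizable_deg t : deg (nv t) <> n -> realizable (delta t).
Proof.
move=> tn; exists 0 => [|u un]; first exact: grading0.
by rewrite linear0 ffunE; case: eqP => // ut; case: tn; rewrite -ut.
Qed.

Lemma realizable_valid t : valid (nv t) -> realizable (delta t).
Proof.
move=> vt; case: (eqVneq (deg (nv t)) n) => [tn|/eqP]; last exact: realizable_deg.
exists (vmon (nv t)) => [|u un]; first by have := vmon_hom vt; rewrite tn.
by rewrite xi_pair // ffunE (inj_eq (@nv_inj _ _)).
Qed.

Let sum_realizable (P : pred T) (F : T -> {ffun T -> int}) :
  (forall t, P t -> realizable (F t)) -> realizable (\sum_(t | P t) F t).
Proof. exact: (subgroup_sum realizable0 realizableB). Qed.

(** The product [w] has value [m] at the pure power [t] and 0 at the other pure powers; its values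
    at valid monomials are removed by [realizable_valid]. *)
Lemma realizable_muln t m i : nv t = mscale m (mone i) -> (k i * m)%N = n ->
  (1 < m)%N -> realizable (delta t *+ m).
Proof.
move=> tE km; case: m => // q in tE km * => q0.
have kq : (k i * q < n)%N by have := k_gt0 i; rewrite -km mulnS; lia.
pose w := X i q * X i 1%N.
have Gw : G n w.
  rewrite -km mulnS addnC /w; apply: GM; first exact: XG.
  by rewrite -[X in G X]muln1; apply: XG; rewrite muln1.
pose v := [ffun u : T => dmon xi (nv u) w : int] : {ffun T -> int}.
have rv : realizable v by exists w => // u _; rewrite ffunE.
have -> : delta t *+ q.+1 = v - \sum_(u | u != t) delta u *~ v u.
  rewrite {1}[v]ffun_delta (bigD1 t) //= addrK.
  by rewrite ffunE tE dmonZ dmon1 conv_exp_mul_primitive // natz.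
apply: realizableB => //; apply: sum_realizable => u ut.
have [un|/eqP un] := eqVneq (deg (nv u)) n; last first.
  by apply: (subgroup_mulz realizable0 realizableB); exact: realizable_deg.
have [vu|vu] := pselect (valid (nv u)).
  by apply: (subgroup_mulz realizable0 realizableB); exact: realizable_valid.
have [l [m [uE lm m1]]] := not_valid_pure un vu.
rewrite ffunE uE dmonZ dmon1 conv_exp_mul_primitive_neq ?mulr0z //; first exact: realizable0.
apply: contra_neq ut => li; apply: nv_inj; rewrite uE tE li; congr mscale.
apply/eqP; rewrite -(eqn_pmul2l (k_gt0 i)) km -lm li //.
Qed.

(** The exponent of a pure power of degree [n] divides [n], so the single multiplier [n] serves all
    coordinates. *)
Lemma realizable_muln_deg t : realizable (delta t *+ n).
Proof.
have [tn|/eqP tn] := eqVneq (deg (nv t)) n; last first.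
  by apply: (subgroup_muln realizable0 realizableB); exact: realizable_deg.
have [vt|vt] := pselect (valid (nv t)).
  by apply: (subgroup_muln realizable0 realizableB); exact: realizable_valid.
have [i [m [tE km m1]]] := not_valid_pure tn vt.
have -> : delta t *+ n = delta t *+ m *+ k i by rewrite -mulrnA mulnC km.
apply: (subgroup_muln realizable0 realizableB); exact: realizable_muln tE km m1.
Qed.

Definition realizable_mod p (v : {ffun T -> int}) : Prop :=
  exists s y, realizable s /\ v = s + y *+ p.

Lemma realizable_mod0 p : realizable_mod p 0.
Proof. by exists 0, 0; rewrite mul0rn addr0; split=> //; exact: realizable0. Qed.

Lemma realizable_modB p v w :
  realizable_mod p v -> realizable_mod p w -> realizable_mod p (v - w).
Proof.
move=> [s [y [rs ->]]] [s' [y' [rs' ->]]]; exists (s - s'), (y - y').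
by split; [exact: realizableB|rewrite mulrnBl opprD addrACA].
Qed.

(** For a pure power the exponent [m] is then prime to [p], so that [realizable_muln] can be divided
    by [m] modulo [p]. *)
Lemma realizable_mod_coprime p t : prime p -> ~~ [forall i, p %| nv t i]%N ->
  realizable_mod p (delta t).
Proof.
move=> pp; rewrite negb_forall => /existsP[j pj].
have rmod v : realizable v -> realizable_mod p v.
  by move=> rv; exists v, 0; rewrite mul0rn addr0.
have [tn|/eqP tn] := eqVneq (deg (nv t)) n; last by apply: rmod; exact: realizable_deg.
have [vt|vt] := pselect (valid (nv t)); first by apply: rmod; exact: realizable_valid.
have [i [m [tE km m1]]] := not_valid_pure tn vt.
have pm : coprime m p.
  rewrite coprime_sym prime_coprime //; apply: contra pj => pm.
  by rewrite tE ffunE dvdn_mulr.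
have m0 : (0 < m)%N by exact: ltnW.
(* A Bezout relation: [u] is an inverse of [m] modulo [p]. *)
case: (egcdnP p m0) => u v uv _; move: uv; rewrite (eqP pm) => uv.
exists (delta t *+ m *+ u), (- (delta t *+ v)); split.
  apply: (subgroup_muln realizable0 realizableB); exact: realizable_muln tE km m1.
by rewrite mulNrn -!mulrnA (mulnC m u) uv addn1 mulrS addrK.
Qed.

Variable V : forall (p : nat) (hp : prime p), {linear reduction hp H -> reduction hp H}.
Hypothesis shift : forall p (hp : prime p), is_shift (reduction_coalgebra hp D) (V hp).
Hypothesis onto : forall p (hp : prime p) (y : reduction hp H), exists x, V hp x = y.

(** Modulo [p], the value at [z] of the [p]-th power of [dmon xi c] is the value of [dmon xi c] at
    the shift of [z], that is, at [vmon a]. *)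
Lemma shift_pairing p (hp : prime p) a z : valid a -> V hp (red hp z) = red hp (vmon a) ->
  forall c, (p %| (dmon xi (mscale p c) z : int) - (c == a)%:R)%Z.
Proof.
move=> va Vz c; rewrite (dvdz_pcharf (pchar_Fp hp)) rmorphB /= subr_eq0.
have := shift (rdual (hp := hp) (dmon xi c)) (red hp z).
rewrite Vz /= rdual_red conv_exp_rdual -dmonZ xi_pair // => <-.
by rewrite eq_sym.
Qed.

(** Only the unit vectors at multi-indices divisible by [p] remain; for these, take a preimage under
    the shift of the monomial with exponents divided by [p]. *)
Lemma realizable_mod_all p v : prime p -> realizable_mod p v.
Proof.
move=> hp; rewrite [v]ffun_delta.
have smod := subgroup_mulz (realizable_mod0 p) (@realizable_modB p).
apply: (subgroup_sum (realizable_mod0 p) (@realizable_modB p)) => t _; apply: (smod).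
have [pt|] := boolP [forall i, p %| nv t i]%N; last exact: realizable_mod_coprime.
have [tn|/eqP tn] := eqVneq (deg (nv t)) n; last first.
  exists (delta t), 0; rewrite mul0rn addr0; split=> //; exact: realizable_deg.
pose a : M := [ffun i => (nv t i %/ p)%N].
have tE : nv t = mscale p a.
  by apply/ffunP => i; rewrite [RHS]ffunE [a i]ffunE mulnC divnK //; exact: (forallP pt).
have pa : (p * deg a)%N = n by rewrite -mdegZ -tE.
(* The degree of [a] is [n] divided by [p], hence below [n] as [n] is positive. *)
have va : valid a.
  apply: valid_deg; rewrite -pa ltn_Pmull ?prime_gt1 //.
  by rewrite lt0n; apply: contraTneq n_gt0 => a0; rewrite -pa a0 muln0.
have [c Vc] := onto (red hp (vmon a)).
have := Vc; rewrite -[c]redK => /(shift_pairing va) zE {Vc}.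
move: (repr c) zE => z zE.
(* The preimage [z] need not be homogeneous, but its component of degree [n] has the same values. *)
have [pi [piG piK pi0 pi_sum]] := grading_proj gr.
have hpi u : deg (nv u) = n -> dmon xi (nv u) (pi n z) = dmon xi (nv u) z.
  by move=> un; apply: (homogeneous_pi _ piG pi_sum pi0); rewrite -un; exact: dmon_hom.
pose w := [ffun u : T => dmon xi (nv u) (pi n z) : int] : {ffun T -> int}.
have rw : realizable_mod p w.
  by exists w, 0; rewrite mul0rn addr0; split=> //; exists (pi n z) => // u _; rewrite ffunE.
(* In degree [n] the difference [w - delta t] is divisible by [p] at multi-indices divisible by [p];
   at the others it is covered by [realizable_mod_coprime]. *)
have -> : delta t = w - (w - delta t) by rewrite opprB addrC subrK.
apply: realizable_modB => //; rewrite [w - _]ffun_delta.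
apply: (subgroup_sum (realizable_mod0 p) (@realizable_modB p)) => u _.
have [pu|pu] := boolP [forall i, p %| nv u i]%N; last first.
  by apply: (smod); exact: realizable_mod_coprime.
have [un|/eqP un] := eqVneq (deg (nv u)) n; last first.
  apply: (smod); exists (delta u), 0; rewrite mul0rn addr0; split=> //; exact: realizable_deg.
pose b : M := [ffun i => (nv u i %/ p)%N].
have uE : nv u = mscale p b.
  by apply/ffunP => i; rewrite [RHS]ffunE [b i]ffunE mulnC divnK //; exact: (forallP pu).
have /dvdzP[q qE] := zE b.
exists 0, (delta u *~ q); split; first exact: realizable0.
rewrite add0r pmulrn -mulrzA; congr (_ *~ _).
rewrite !ffunE hpi // -qE uE; congr (_ - (nat_of_bool _)%:R).
rewrite -(inj_eq (@nv_inj _ _)) tE uE; apply/eqP/eqP => [/ffunP e|-> //].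
apply/ffunP => i; have := e i; rewrite !ffunE => /eqP.
by rewrite eqn_pmul2l ?prime_gt0 // => /eqP.
Qed.

(** The realizable vectors contain [n] times the lattice and fill it modulo every prime, so
    [full_subgroup] applies. *)
Lemma realizable_all v : realizable v.
Proof.
apply: (full_subgroup realizable0 realizableB n_gt0) => [x|p hp x].
  2: by exact: realizable_mod_all.
rewrite [x]ffun_delta -sumrMnl; apply: sum_realizable => t _.
rewrite !pmulrn mulrzAC -pmulrn; apply: (subgroup_mulz realizable0 realizableB).
exact: realizable_muln_deg.
Qed.

(* Take [z] on which, in degree [n], only the monomial [xi j ^ m] is nonzero. *)
Lemma divided_power_step j m : (k j * m)%N = n -> (1 < m)%N ->
  exists2 z, G n z & comul D z =
    \sum_(i < m.+1) pure (if i == m :> nat then z else X j i)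
                         (if (m - i)%N == m then z else X j (m - i)%N).
Proof.
move=> km m1; set b := mscale m (mone j).
have bn : deg b = n by rewrite mdeg_pure.
have [|t0 t0E] := @nv_surj_deg _ _ k_gt0 n b; first by rewrite bn.
have [z Gz zE] := realizable_all (delta t0).
have dz c : deg c = n -> dmon xi c z = (c == b)%:R :> int.
  move=> cn; have [|t tE] := @nv_surj_deg _ _ k_gt0 n c; first by rewrite cn.
  by rewrite -tE zE ?tE // ffunE -(inj_eq (@nv_inj _ _)) tE t0E.
exists z => //.
rewrite (comul_expand xi_hom _ n_gt0 Gz); last by move=> d' /andP[_]; exact: xi_span.
(* The new term [z] occurs only at the extreme indices [m] and 0, giving [pure z 1] and
   [pure 1 z]. *)
rewrite [RHS](bigD1 ord_max) //= eqxx subnn X0 ifN ?neq_ltn ?(ltnW m1) //.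
rewrite (bigD1 ord0) /=; last by rewrite -val_eqE /= neq_ltn (ltnW m1).
rewrite subn0 eqxx X0 ifN ?neq_ltn ?(ltnW m1) // -addrA; congr (_ + (_ + _)).
(* The inner terms are matched by a map [h] that splits the exponent [m] of generator [j] into [i]
   and [m - i]. *)
have ex (i : 'I_m.+1) : exists q : T * T,
    nv q.1 = mscale i (mone j) /\ nv q.2 = mscale (m - i) (mone j).
  have le e : (e <= m)%N -> exists t : T, nv t = mscale e (mone j).
    by move=> em; apply: nv_surj_deg => //; rewrite mdeg_pure -km leq_mul.
  have [t tE] := le i (leq_ord i); have [u uE] := le (m - i)%N (leq_subr _ _).
  by exists (t, u).
have [h hE] := choice ex.
have h_inj : injective h.
  move=> i i' e; apply: ord_inj; have := (hE i).1; rewrite e (hE i').1.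
  by move=> /ffunP /(_ j); rewrite !ffunE eqxx !muln1.
pose A := [pred i : 'I_m.+1 | (i != ord_max) && (i != ord0)].
pose F (q : T * T) := pure (vmon (nv q.1)) (vmon (nv q.2)).
transitivity (\sum_(q in [set h i | i in A]%SET) F q); last first.
  rewrite big_imset /=; last by move=> ? ? _ _; exact: h_inj.
  apply: eq_bigr => i /andP[im i0]; rewrite /F (hE i).1 (hE i).2 !vmon_pure.
  rewrite ifN; last by rewrite -val_eqE in im.
  rewrite ifN //; move: i0 im; rewrite -!val_eqE /=; have := ltn_ord i; lia.
rewrite pair_big_dep /= [LHS](eq_bigr (fun q : T * T =>
    if madd (nv q.1) (nv q.2) == b then F q else 0)); last first.
  move=> [t u] /= /andP[_ /andP[_ /eqP tu]]; rewrite dz ?mdegD //.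
  by case: eqP; rewrite ?scale1r ?scale0r.
rewrite -big_mkcondr; apply: eq_bigl => -[t u] /=.
apply/andP/imsetP => [[/and3P[dt du _] /eqP tub]|[i]].
  (* Summands of a multi-index supported at [j] are themselves supported at [j]. *)
  have tuE l : (t l + u l = m * (l == j))%N.
    by have /ffunP/(_ l) := tub; rewrite !ffunE.
  have tm : (t j < m.+1)%N.
    by have := tuE j; rewrite eqxx muln1 ltnS => <-; rewrite leq_addr.
  have tE : nv t = mscale (t j) (mone j).
    apply/ffunP => l; rewrite !ffunE; case: eqP => [-> |lj]; first by rewrite muln1.
    by have := tuE l; case: eqP => // _; rewrite !muln0; lia.
  have uE : nv u = mscale (m - t j) (mone j).
    apply/ffunP => l; rewrite !ffunE; case: eqP => [-> |lj].
      by have := tuE j; rewrite eqxx !muln1; lia.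
    by have := tuE l; case: eqP => // _; rewrite !muln0; lia.
  exists (Ordinal tm).
    rewrite inE -!val_eqE /=; apply/andP; split.
      by apply: contraTneq du => e; rewrite uE mdeg_pure e subnn muln0.
    by apply: contraTneq dt => e; rewrite tE mdeg_pure e muln0.
  have [e1 e2] := hE (Ordinal tm).
  by rewrite [h _]surjective_pairing; congr pair; apply: (@nv_inj _ n); rewrite ?e1 ?e2.
move=> /andP[]; rewrite -!val_eqE /= => im i0 e.
have := hE i; rewrite -e /= => -[-> ->].
rewrite !mdeg_pure -mulnDr subnKC ?leq_ord // km eqxx !muln_gt0 !k_gt0 andbT /=.
split; first by rewrite lt0n i0 subn_gt0 ltn_neqAle im leq_ord.
by apply/eqP/ffunP => l; rewrite !ffunE -mulnDl subnKC // leq_ord.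
Qed.

End Core.

(** * Construction of the lifts *)

Section Lifting.
Variables (H : algType int) (D : coalgebra H) (G : nat -> set H).
Hypothesis graded : is_graded_bialgebra D G.
Hypothesis cocomm : cocommutative D.
Hypothesis connected : G 0%N = [set x | exists c : int, x = c *: 1]%classic.
Variable V : forall (p : nat) (hp : prime p), {linear reduction hp H -> reduction hp H}.
Hypothesis shift : forall p (hp : prime p), is_shift (reduction_coalgebra hp D) (V hp).
Hypothesis onto : forall p (hp : prime p) (y : reduction hp H), exists x, V hp x = y.

Let bialg : is_bialgebra D. Proof. by case: graded => -[]. Qed.
Let gr : is_grading G. Proof. by case: graded => -[]. Qed.
Let G1 : G 0%N 1. Proof. by case: graded. Qed.

(** For a multiple [x] of 1, the counit law applied to the coproduct of a primitive reads
    [x + x = x]. *)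
Lemma primitive_deg0 x : G 0%N x -> primitive D x -> x = 0.
Proof.
rewrite connected => -[c ->] px.
have c1 : counit D (1 : H) = 1 by case: bialg => _ [].
have bl := counit_balancedl (counit D).
have := counitl D (c *: 1); rewrite px tliftD // !tliftE // functionalZ c1 mulr1 scale1r.
by move=> /eqP; rewrite -subr_eq0 addrK => /eqP.
Qed.

Variables (r : nat -> nat) (e : forall d, 'I_(r d) -> H).
Hypothesis e_span : forall d x, (G d x /\ primitive D x) <->
  exists c : 'I_(r d) -> int, x = \sum_l c l *: e l.
Hypothesis e_free : forall d (c : 'I_(r d) -> int),
  \sum_l c l *: e l = 0 -> forall l, c l = 0.

Local Notation J := {d : nat & 'I_(r d)}.

Lemma e_primitive (j : J) : G (tag j) (e (tagged j)) /\ primitive D (e (tagged j)).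
Proof.
apply/e_span; exists (fun l => (l == tagged j)%:R).
rewrite (bigD1 (tagged j)) //= eqxx scale1r big1 ?addr0 // => l /negbTE ->.
by rewrite scale0r.
Qed.

(** A basis vector of degree 0 would vanish, against freeness. *)
Lemma tag_gt0 (j : J) : (0 < tag j)%N.
Proof.
case: j => -[|d] l //; have [/= G0 p0] := e_primitive (existT _ 0%N l).
have e0 := primitive_deg0 G0 p0.
suff /e_free/(_ l) : \sum_l' (l' == l)%:R *: e l' = 0 by rewrite eqxx.
by rewrite big1 // => l' _; case: eqP => [->|_]; rewrite ?e0 ?scaler0 ?scale0r.
Qed.

(** One sequence per basis primitive; beyond the two prescribed terms, those of degree at least [n]
    are placeholders. *)
Definition divided_below n (X : J -> nat -> H) : Prop :=
  forall j, [/\ X j 0%N = 1, X j 1%N = e (tagged j) &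
    forall m, (tag j * m < n)%N -> G (tag j * m)%N (X j m) /\
      comul D (X j m) = \sum_(i < m.+1) pure (X j i) (X j (m - i)%N)].

Lemma extend_divided_power n X j m : divided_below n X ->
  (tag j * m)%N = n -> (1 < m)%N -> exists z, G n z /\ comul D z =
    \sum_(i < m.+1) pure (if i == m :> nat then z else X j i)
                         (if (m - i)%N == m then z else X j (m - i)%N).
Proof.
move=> XP jm m1.
have jn : (tag j < n)%N by rewrite -jm -[X in (X < _)%N]muln1 ltn_pmul2l ?tag_gt0.
have n0 : (0 < n)%N by exact: leq_ltn_trans jn.
(* Only the generators of degree below [n] matter, and these form a finite type. *)
pose I := {d : 'I_n & 'I_(r d)}.
pose emb (i : I) : J := existT _ (tag i : nat) (tagged i).
pose k i := tag (emb i); pose Y i := X (emb i).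
have sumI d (dn : (d < n)%N) (F : I -> H) :
    \sum_(i : I | k i == d) F i = \sum_(l : 'I_(r d)) F (existT _ (Ordinal dn) l).
  pose F' (d' : 'I_n) (l : 'I_(r d')) := F (existT (fun d' : 'I_n => 'I_(r d')) d' l).
  transitivity (\sum_(d' : 'I_n | d' == Ordinal dn) \sum_(l : 'I_(r d')) F' d' l).
    rewrite sig_big_dep /=; apply: eq_big => [i|[] //]; by rewrite andbT -val_eqE.
  by rewrite big_pred1_eq.
have Y1 i : Y i 1%N = e (tagged i) by have [] := XP (emb i).
have k0 i : (0 < k i)%N by exact: tag_gt0.
have Y0 i : Y i 0%N = 1 by have [] := XP (emb i).
have YG i q : (k i * q < n)%N -> G (k i * q)%N (Y i q).
  by have [_ _ h] := XP (emb i) => /h[].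
have YD i q : (k i * q < n)%N ->
    comul D (Y i q) = \sum_(l < q.+1) pure (Y i l) (Y i (q - l)%N).
  by have [_ _ h] := XP (emb i) => /h[].
have kn i : (k i < n)%N by exact: ltn_ord.
have Y_span d : (0 < d < n)%N -> forall z, G d z -> primitive D z ->
    exists c : I -> int, z = \sum_(i | k i == d) c i *: Y i 1%N.
  move=> /andP[_ dn] z Gz pz; have /e_span[c zE] := conj Gz pz.
  (* Passing through [insub] avoids a transport along the equality of degrees; the default 0 is
     never met in the sum over degree [d]. *)
  pose c' (i : J) := oapp c 0 (insub (tagged i : nat)).
  exists (fun i => c' (emb i)).
  under eq_bigr => i _ do rewrite Y1.
  rewrite (sumI d dn (fun i => c' (emb i) *: e (tagged i))) zE.
  by apply: eq_bigr => l _; rewrite /c' /= valK.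
have Y_free d (c : I -> int) : \sum_(i | k i == d) c i *: Y i 1%N = 0 ->
    forall i, k i == d -> c i = 0.
  move=> s0 i /eqP ki.
  have dn : (d < n)%N by rewrite -ki.
  move: s0; under eq_bigr => u _ do rewrite Y1.
  rewrite (sumI d dn (fun i => c i *: e (tagged i))) => /e_free.
  case: i ki => -[d' dn'] l ki; have {}ki : d' = d by []. subst d'.
  by move=> /(_ l); rewrite (bool_irrelevance dn dn').
(* With [m = n.-1] every generator has been treated. *)
have [|xi [xi_dual xi_span]] := dual_exists graded cocomm connected k0 Y0 YG YD
  Y_span Y_free kn (m := n.-1); first by rewrite ltn_predL.
rewrite prednK // in xi_dual xi_span.
have xi_pair a b : valid k n b -> dmon D xi a (vmon Y b) = (a == b)%:R :> int.
  move=> vb; rewrite (pairing graded cocomm k0 Y0 YG YD _ xi_dual vb).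
  by rewrite (_ : [forall i, _]) ?andbT //; apply/forallP => i; rewrite kn implybT.
pose i0 : I := existT (fun d : 'I_n => 'I_(r d)) (Ordinal jn) (tagged j).
have emb0 : emb i0 = j by have eta (q : J) : Tagged _ (tagged q) = q; [case: q|exact: eta].
have k_i0 : (k i0 * m)%N = n by [].
have [z Gz zE] := divided_power_step graded cocomm connected k0 Y0 YG YD kn
  (proj1 xi_dual) xi_pair xi_span n0 shift onto k_i0 m1.
by exists z; split=> //; rewrite zE /Y emb0.
Qed.

Lemma divided_belowS n X : divided_below n X -> exists X',
  divided_below n.+1 X' /\ forall j m, (tag j * m < n)%N -> X' j m = X j m.
Proof.
move=> XP.
have ex (q : J * nat) : exists z, (tag q.1 * q.2)%N = n -> (1 < q.2)%N ->
    G n z /\ comul D z =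
    \sum_(i < q.2.+1) pure (if i == q.2 :> nat then z else X q.1 i)
                         (if (q.2 - i)%N == q.2 then z else X q.1 (q.2 - i)%N).
  have [qn|qn] := pselect ((tag q.1 * q.2)%N = n /\ (1 < q.2)%N).
    by have [z zP] := extend_divided_power XP qn.1 qn.2; exists z.
  by exists 0 => e1 e2; case: qn.
have [z zP] := choice ex.
(* Indices 0 and 1 are left alone, so the prescribed terms survive. *)
pose X' j m := if ((tag j * m)%N == n) && (1 < m)%N then z (j, m) else X j m.
have X'lt j m : (tag j * m < n)%N -> X' j m = X j m.
  by move=> jm; rewrite /X' ltn_eqF.
exists X'; split=> // j; have [X0 X1 XG] := XP j; split.
- by rewrite /X' andbF.
- by rewrite /X' andbF.
move=> m; rewrite ltnS leq_eqVlt => /predU1P[jm|jm]; last first.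
  have [Gm Dm] := XG m jm; rewrite X'lt //; split=> //; rewrite Dm.
  apply: eq_bigr => i _; rewrite !X'lt //.
    by apply: leq_ltn_trans jm; rewrite leq_mul // leq_subr.
  by apply: leq_ltn_trans jm; rewrite leq_mul // leq_ord.
have [m1|m1] := ltnP 1 m.
  have [Gz Dz] := zP (j, m) jm m1.
  have X'm i : (i <= m)%N -> X' j i = if i == m then z (j, m) else X j i.
    case: eqP => [-> _|im le]; first by rewrite /X' jm eqxx m1.
    by rewrite X'lt // -jm ltn_pmul2l ?tag_gt0 // ltn_neqAle le andbT; apply/eqP.
  rewrite X'm // eqxx jm; split=> //; rewrite Dz; apply: eq_bigr => i _ /=.
  by rewrite !X'm ?leq_subr ?leq_ord.
have X'E i : (i <= m)%N -> X' j i = X j i.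
  by move=> im; rewrite /X' [(1 < i)%N]ltnNge (leq_trans im m1) andbF.
(* At the remaining indices 0 and 1, the formula is the coproduct of 1 and the primitivity of the
   basis vector. *)
rewrite X'E //; case: m m1 jm X'E => [|[|//]] _ jm X'E.
  rewrite muln0 X0; split=> //; rewrite (comul1 bialg).
  by rewrite big_ord_recl big_ord0 addr0 X'E // X0.
have [Ge pe] := e_primitive j.
rewrite muln1 X1; split=> //; rewrite pe.
by rewrite !big_ord_recl big_ord0 /= !X'E // X0 X1 addr0 addrC.
Qed.

(** By [divided_belowS] successive approximations agree wherever they are already controlled, so
    each term stabilizes. *)
Lemma basis_liftable (j : J) : liftable D (e (tagged j)).
Proof.
have start : divided_below 0 (fun j m => if m == 0%N then 1 else e (tagged j)).
  by move=> i; split.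
pose S n := {X | divided_below n X}.
have next n (s : S n) : exists s' : S n.+1,
    forall i m, (tag i * m < n)%N -> sval s' i m = sval s i m.
  by have [X' [X'P X'E]] := divided_belowS (svalP s); exists (exist _ X' X'P).
pose step n (s : S n) : S n.+1 := projT1 (cid (next n s)).
have stepE n (s : S n) i m : (tag i * m < n)%N -> sval (step n s) i m = sval s i m.
  exact: (projT2 (cid (next n s))).
pose fix approx n : S n := if n is n'.+1 then step n' (approx n') else exist _ _ start.
(* Term [m] has degree [tag j * m] and is final from the next stage on. *)
pose X m := sval (approx (tag j * m).+1) j m.
have XE n m : (tag j * m < n)%N -> sval (approx n) j m = X m.
  move=> jm; rewrite /X; elim: n jm => // n IH; rewrite ltnS leq_eqVlt => /predU1P[<- //|jm].
  by rewrite /= stepE // IH.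
exists X; split=> [||m].
- by have [] := svalP (approx (tag j * 0).+1) j.
- by have [] := svalP (approx (tag j * 1).+1) j.
have [_ _ /(_ m (ltnSn _)) [_ ->]] := svalP (approx (tag j * m).+1) j.
apply: eq_bigr => i _; rewrite !XE //.
  by rewrite ltnS leq_mul // leq_subr.
by rewrite ltnS leq_mul // leq_ord.
Qed.

End Lifting.

Theorem theorem2p12 (H : algType int) (D : coalgebra H) (G : nat -> set H)
  (graded : is_graded_bialgebra D G)
  (cocomm : cocommutative D)
  (free : forall n, fg_free (G n))
  (connected : G 0%N = [set x | exists c : int, x = c *: 1]%classic)
  (V : forall (p : nat) (hp : prime p), {linear reduction hp H -> reduction hp H})
  (shift : forall p (hp : prime p), is_shift (reduction_coalgebra hp D) (V p hp))
  (onto : forall p (hp : prime p) (y : reduction hp H), exists x, V p hp x = y)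
  (a : H) (ha : primitive D a) :
  liftable D a.
Proof.
have gr : is_grading G by case: graded => -[].
have bialg : is_bialgebra D by case: graded => -[].
(* The primitives of degree [d] form a subgroup of the lattice [G d], so they have a finite
   basis. *)
have ex d : exists B : {r : nat & 'I_r -> H},
    (forall x, (G d x /\ primitive D x) <->
       exists c : 'I_(projT1 B) -> int, x = \sum_l c l *: projT2 B l) /\
    (forall c : 'I_(projT1 B) -> int, \sum_l c l *: projT2 B l = 0 -> forall l, c l = 0).
  have [||x y [Gx px] [Gy py]|r [e [PE ind]]] :=
      @fg_free_sub H (G d) [set x | G d x /\ primitive D x]%classic (free d).
  - by move=> x [].
  - by split; [exact: grading0|rewrite /primitive linear0 pure0l pure0r addr0].
  - split; first exact: gradingB.
    rewrite /primitive linearB /= px py -scaleN1r !(pureDl, pureDr) pureZl pureZr.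
    by rewrite scaleN1r opprD addrACA.
  exists (existT _ r e); split=> // x.
  by have /(congr1 (fun P : set H => P x)) := PE; rewrite /= => ->.
have [B BP] := choice ex.
pose r d := projT1 (B d); pose e d : 'I_(r d) -> H := projT2 (B d).
have e_lift d l : liftable D (@e d l).
  exact: (basis_liftable graded cocomm connected shift onto
    (fun d => (BP d).1) (fun d => (BP d).2) (existT _ d l)).
have lift_sum (I : finType) (F : I -> H) :
    (forall i, liftable D (F i)) -> liftable D (\sum_i F i).
  move=> hF; elim/big_ind: _ => //; [exact: liftable0|exact: liftableD].
have [pi [piG piK pi0 pi_sum]] := grading_proj gr.
(* The components of [a] are primitive, and liftable elements are closed under sums and integer
   multiples, so the basis primitives suffice. *)
have [N ->] := pi_sum a; apply: (lift_sum) => d.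
have pa : primitive D (pi d a) by exact: (primitive_components graded).
have /(BP d).1[c ->] := conj (piG d a) pa.
by apply: (lift_sum) => l; apply: liftableZ; exact: e_lift.
Qed.
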